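(* Let $C_1:f_1=0$ and $C_2:f_2=0$ be two distinct smooth conics in $\mathbb{P}^2$, let $C=C_1\cup C_2:f=f_1f_2=0$ and let $r=mdr(f)$. Then $C_1$ and $C_2$ are in one of the following four situations. (1) $|C_1\cap C_2|=4$, and then all the intersection points are nodes for $C$. In this case $r=2$. (2) $|C_1\cap C_2|=3$, and then one intersection point is a tacnode and the other two intersection points are nodes for $C$. In this case $r=2$. (3) $|C_1\cap C_2|=2$. Then the two intersection points are either two tacnodes for $C$, and in this case $r=1$ and the curve $C$ is nearly free with exponents $(1,3)$, or a node $A_1$ and a singularity $A_5$ for $C$, and in this case $r=2$ and the curve $C$ is nearly free with exponents $(2,2)$. (4) $|C_1\cap C_2|=1$, and then the intersection point is a singularity $A_7$ for $C$, $r=1$ and $C$ is a free curve.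
   Context: $S=\mathbb{C}[x,y,z]$. For a homogeneous polynomial $g\in S$ of degree $e$, $AR(g)=\{(a,b,c)\in S^3: ag_x+bg_y+cg_z=0\}$ is the graded $S$-module of Jacobian syzygies of $g$ (with $AR(g)_s$ the triples with entries in $S_s$), and $mdr(g)=\min\{s\in\mathbb{N}: AR(g)_s\ne0\}$. Let $d_1'\le d_2'\le\dots\le d_m'$ be the degrees of a minimal set of homogeneous generators of $AR(g)$. The reduced curve $C_g:g=0$ is free if $AR(g)$ is a free graded $S$-module (equivalently $m=2$ and $d_1'+d_2'=e-1$); it is nearly free with exponents $(d_1',d_2')$ if $m=3$, $d_1'+d_2'=e$ and $d_3'=d_2'$. A plane curve singularity of type $A_k$ is one given in suitable local analytic coordinates by $u^2+v^{k+1}=0$; a node is $A_1$, a tacnode is $A_3$. *)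

(* Defs.v *)
From mathcomp Require Import all_boot all_order all_algebra.
From mathcomp Require Import all_classical all_reals all_analysis.
(* The notations of mpoly clash with those of the analysis library. *)
From mathcomp Require Import -(notations) mpoly.

Set Implicit Arguments.
Unset Strict Implicit.
Unset Printing Implicit Defensive.

Import Order.TTheory GRing.Theory Num.Theory numFieldNormedType.Exports.

Local Open Scope classical_set_scope.
Local Open Scope card_scope.
Local Open Scope ring_scope.

(* The ground field K is arbitrary here so that the topology of K-vector spaces
   is inferred; it is to be taken to be the complex numbers. *)
Notation polyS K := (mpoly 3 K).
Notation homog d := (ishomog1 d mdeg).

Local Notation pderiv i g := (mderiv i g).
Local Notation eval g v := (meval (fun_of_matrix v 0) g).

(* A point of the projective plane is a line through the origin of K^3. *)
Definition P2 (K : numFieldType) : set {vspace 'rV[K]_3} :=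
  [set p | \dim p = 1%N].

Definition curve (K : numFieldType) (g : polyS K) : set {vspace 'rV[K]_3} :=
  [set p | P2 p /\ forall v : 'rV[K]_3, v \in p -> eval g v = 0].

Definition smooth (K : numFieldType) (g : polyS K) : Prop :=
  forall v : 'rV[K]_3, v != 0 -> eval g v = 0 ->
    exists i : 'I_3, eval (pderiv i g) v != 0.

Definition smooth_conic (K : numFieldType) (g : polyS K) : Prop :=
  g \is homog 2 /\ smooth g.

Definition AR (K : numFieldType) (g : polyS K) : set 'rV[polyS K]_3 :=
  [set v | \sum_(i < 3) v 0 i * pderiv i g = 0].

Definition AR_deg (K : numFieldType) (g : polyS K) (s : nat) :
    set 'rV[polyS K]_3 :=
  [set v | AR g v /\ forall i : 'I_3, v 0 i \is homog s].

(* The set on the right has at most one element, and it has one as soon as g is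
   homogeneous; the default value 0 is used when it is empty. *)
Definition mdr (K : numFieldType) (g : polyS K) : nat :=
  xget 0%N [set s | AR_deg g s != [set 0] /\
                    forall t, AR_deg g t != [set 0] -> (s <= t)%N].

(* The S-submodule of S^3 spanned by the w i for i \in J. *)
Definition submodule_span (K : numFieldType) m (w : 'I_m -> 'rV[polyS K]_3)
    (J : {set 'I_m}) : set 'rV[polyS K]_3 :=
  [set v | exists a : 'I_m -> polyS K, v = \sum_(i in J) a i *: w i].

(* d is the nondecreasing sequence of the degrees of a minimal set of
   homogeneous generators of AR g. *)
Definition AR_generator_degrees (K : numFieldType) (g : polyS K) (d : seq nat) :
    Prop :=
  sorted leq d /\
  exists w : 'I_(size d) -> 'rV[polyS K]_3,
    [/\ forall i : 'I_(size d), AR_deg g (nth 0%N d i) (w i),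
        AR g = submodule_span w [set: 'I_(size d)]%SET
      & forall J : {set 'I_(size d)}, AR g = submodule_span w J ->
          J = [set: 'I_(size d)]%SET].

(* AR g is a free graded S-module: it has a homogeneous basis. *)
Definition free_curve (K : numFieldType) (g : polyS K) : Prop :=
  exists m (d : 'I_m -> nat) (w : 'I_m -> 'rV[polyS K]_3),
    [/\ forall i, AR_deg g (d i) (w i),
        AR g = submodule_span w [set: 'I_m]%SET
      & forall a : 'I_m -> polyS K, \sum_i a i *: w i = 0 ->
          forall i, a i = 0].

(* For a nonzero homogeneous g, (mmeasure mdeg g).-1 is the degree of g. *)
Definition nearly_free (K : numFieldType) (g : polyS K) (d1 d2 : nat) : Prop :=
  AR_generator_degrees g [:: d1; d2; d2] /\
  (d1 + d2 = (mmeasure mdeg g).-1)%N.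

(* The i-th standard affine chart K^2 -> P^2: the vector with i-th coordinate 1
   and with the entries of q, in order, as its other coordinates. *)
Definition chart (K : numFieldType) (i : 'I_3) (q : 'rV[K]_2) : 'rV[K]_3 :=
  \row_j oapp (fun k : 'I_2 => q 0 k) 1 (unlift i j).

(* Differentiability over the field of complex numbers is holomorphy. *)
Definition local_coordinates (K : numFieldType)
    (phi : 'rV[K]_2 -> 'rV[K]_2) (a : 'rV[K]_2) : Prop :=
  [/\ phi a = 0,
      \forall q \near a, differentiable phi q
    & 'J phi a \in unitmx].

(* p is a singularity of type A_k of the curve g = 0: near p, up to a
   holomorphic factor e without zeros, the dehomogenization of g is
   u^2 + v^(k+1) for some local analytic coordinates (u, v) = phi. *)
Definition singularity_A (K : numFieldType) (k : nat) (g : polyS K)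
    (p : {vspace 'rV[K]_3}) : Prop :=
  exists (i : 'I_3) (a : 'rV[K]_2),
    p = <[chart i a]>%VS /\
    exists (phi : 'rV[K]_2 -> 'rV[K]_2) (e : 'rV[K]_2 -> K^o),
      [/\ local_coordinates phi a,
          \forall q \near a, differentiable e q,
          e a != 0
        & \forall q \near a,
            eval g (chart i q) =
              e q * ((phi q 0 0) ^+ 2 + (phi q 0 1) ^+ k.+1)].

(* Main.v *)
From HB Require Import structures.
Require Import Defs.
From mathcomp Require Import all_boot all_order all_algebra.
From mathcomp Require Import all_classical all_reals all_analysis.
From mathcomp.real_closed Require Import complex.
From mathcomp Require Import -(notations) mpoly.
From mathcomp Require Import ring.
Import Order.TTheory GRing.Theory Num.Theory numFieldNormedType.Exports.

Local Open Scope classical_set_scope.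
Local Open Scope card_scope.
Local Open Scope ring_scope.

(** Take a common point P of the two conics, and a second one P' if there is any
    (otherwise any other point of the first conic). In suitable coordinates
    P = (1:0:0), P' = (0:0:1), the first conic is x z = y^2, parametrised by
    (s^2 : s t : t^2), and the restriction of the second conic to it is a binary
    quartic a s^3 t + b s^2 t^2 + c s t^3 + d t^4. Its roots are the intersection
    points, and a root of multiplicity m is a singularity A_(2m-1), since locally
    the two conics are F = 0 and al F + be Y^m = 0 with units al and be. If no
    common point is a point of tangency the quartic has four simple roots; if P
    is a point of tangency then a = 0, and the four other root patterns are told
    apart by the vanishing of b and c.
    A vector field v killing f1 f2 satisfies v f1 = h f1 and v f2 = - h f2, as f1
    is prime. In each normal form these two equations are solved by elementary
    divisibility arguments, which gives explicit generators of AR f, or the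
    absence of linear syzygies; a syzygy of degree 2 always exists, namely the
    cross product of the gradients of f1 and f2. *)

Set Implicit Arguments.
Unset Strict Implicit.
Unset Printing Implicit Defensive.

(** The coefficient [l] of the first conic in the second is invisible on the first conic, so the
    root pattern says nothing about it. Smoothness of the second conic supplies [l != 0] at a
    tangency and [l != b] for two tacnodes; both feed the divisibility arguments. Local analysis is
    done at the base point (1:0:0) only: another common point becomes the base point of another
    frame, and tangency, expressed by gradients in K^3, carries information from one frame to the
    other. The analytic coordinates are explicit, so no implicit function theorem enters: only a
    differential at one point is computed. A linear syzygy is a linear vector field preserving the
    first conic, hence comes from gl_2 acting on binary quadratic forms. It exists in two
    configurations: a diagonal torus preserves both conics if they have two tacnodes, a unipotent
    group if they meet in an A_7. This is why r drops to 1 there. *)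

Local Notation o0 := (@Ordinal 3 0 isT).
Local Notation o1 := (@Ordinal 3 1 isT).
Local Notation o2 := (@Ordinal 3 2 isT).
Local Notation pC := (mpolyC 3).
Local Notation X := (mpolyX _ (mnm1 o0)).
Local Notation Y := (mpolyX _ (mnm1 o1)).
Local Notation Z := (mpolyX _ (mnm1 o2)).
Local Notation eval g v := (meval (fun_of_matrix v 0) g).

(** * Polynomials and linear changes of variables *)

Section Mpoly.
Variables (n : nat) (R : comNzRingType).
Implicit Types p q : mpoly n R.

Lemma mpoly_ring_ind (P : mpoly n R -> Prop) :
  (forall c, P (mpolyC n c)) -> (forall i, P (mpolyX R (mnm1 i))) ->
  (forall p q, P p -> P q -> P (p + q)) ->
  (forall p q, P p -> P q -> P (p * q)) -> forall p, P p.
Proof.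
move=> PC PX PD PM p; rewrite (mpolyE p).
apply: big_ind => // [|m _]; first by have := PC 0; rewrite mpolyC0.
rewrite -mul_mpolyC; apply: (PM _ _ (PC _)); rewrite mpolyXE_id.
apply: big_ind => // [|i _]; first by have := PC 1; rewrite mpolyC1.
elim: (m i) => [|k IH]; first by have := PC 1; rewrite mpolyC1 expr0.
by rewrite exprS; apply: PM.
Qed.

Lemma mderivXU (i j : 'I_n) : mderiv i (mpolyX R (mnm1 j)) = (i == j)%:R.
Proof.
rewrite mderivX mnm1E eq_sym; case: eqP => [->|_]; last by rewrite scale0r.
rewrite scale1r (_ : mnm_sub _ _ = mnm0) ?mpolyX0 //.
by apply/mnmP => l; rewrite mnmBE mnm0E subnn.
Qed.

Lemma mderiv_comp_mpoly k (t : n.-tuple (mpoly k R)) (j : 'I_k) p :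
  mderiv j (comp_mpoly t p) =
  \sum_i comp_mpoly t (mderiv i p) * mderiv j (tnth t i).
Proof.
elim/mpoly_ring_ind: p => [c|i|p q Hp Hq|p q Hp Hq].
- rewrite comp_mpolyC mderivC big1 // => i _.
  by rewrite mderivC raddf0 mul0r.
- rewrite comp_mpolyXU -tnth_nth (bigD1 i) //= mderivXU eqxx rmorph1 mul1r.
  by rewrite big1 ?addr0 // => l lDi; rewrite mderivXU (negPf lDi) raddf0 mul0r.
- rewrite raddfD /= linearD /= Hp Hq -big_split; apply: eq_bigr => i _.
  by rewrite linearD raddfD mulrDl.
- rewrite rmorphM mderivM Hp Hq mulr_suml mulr_sumr -big_split /=.
  apply: eq_bigr => i _; rewrite mderivM comp_mpolyD !rmorphM /=; ring.
Qed.

Lemma comp_mpolyA k l (t : n.-tuple (mpoly k R)) (u : k.-tuple (mpoly l R)) p :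
  comp_mpoly u (comp_mpoly t p) = comp_mpoly (map_tuple (comp_mpoly u) t) p.
Proof.
elim/mpoly_ring_ind: p => [c|i|p q Hp Hq|p q Hp Hq].
- by rewrite !comp_mpolyC.
- by rewrite !comp_mpolyXU -!tnth_nth tnth_map.
- by rewrite !raddfD /= Hp Hq.
- by rewrite !rmorphM /= Hp Hq.
Qed.

End Mpoly.

Lemma sum3 (V : nmodType) (F : 'I_3 -> V) : \sum_i F i = F o0 + F o1 + F o2.
Proof.
rewrite !big_ord_recl big_ord0 addr0 addrA.
by congr (F _ + F _ + F _); apply: val_inj.
Qed.

Lemma ord3P (P : 'I_3 -> Prop) : P o0 -> P o1 -> P o2 -> forall i, P i.
Proof.
move=> P0 P1 P2 [[|[|[|i]]] lti] //.
- by rewrite (bool_irrelevance lti isT).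
- by rewrite (bool_irrelevance lti isT).
- by rewrite (bool_irrelevance lti isT).
Qed.

Definition row3 (T : Type) (a b c : T) : 'rV[T]_3 := \row_i nth a [:: a; b; c] i.

Lemma row3E (T : Type) (v : 'rV[T]_3) : v = row3 (v 0 o0) (v 0 o1) (v 0 o2).
Proof. by apply/rowP; apply: ord3P; rewrite mxE. Qed.

Lemma row3_eq (T : Type) (v w : 'rV[T]_3) :
  v 0 o0 = w 0 o0 -> v 0 o1 = w 0 o1 -> v 0 o2 = w 0 o2 -> v = w.
Proof. by move=> e0 e1 e2; apply/rowP; apply: ord3P. Qed.

(** * Linear changes of variables acting on polynomials and syzygies *)

Section Subst.
Variable K : numFieldType.
Implicit Types (M N : 'M[K]_3) (p g : polyS K) (v w : 'rV[polyS K]_3).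

(** Points are row vectors and matrices act on the right: variable [i] becomes the [i]-th entry of
    the generic row times [M]. Hence substitutions compose as [N *m M]. *)
Definition linear_forms M : 3.-tuple (polyS K) :=
  [tuple \sum_k M k i *: mpolyX K (mnm1 k) | i < 3].

Definition subst M p := comp_mpoly (linear_forms M) p.

HB.instance Definition _ M := GRing.RMorphism.copy (subst M) (comp_mpoly (linear_forms M)).

Lemma substC M c : subst M (mpolyC 3 c) = mpolyC 3 c.
Proof. exact: comp_mpolyC. Qed.

Lemma substZ M c p : subst M (c *: p) = c *: subst M p.
Proof. by rewrite -!mul_mpolyC rmorphM /= substC. Qed.

Lemma substX M i :
  subst M (mpolyX K (mnm1 i)) = \sum_k M k i *: mpolyX K (mnm1 k).
Proof. by rewrite /subst comp_mpolyXU -tnth_nth tnth_mktuple. Qed.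

Lemma eval_subst M p (v : 'rV[K]_3) : eval (subst M p) v = eval p (v *m M).
Proof.
rewrite /subst comp_mpoly_meval; apply: meval_eq => i.
rewrite tnth_mktuple raddf_sum mxE; apply: eq_bigr => k _ /=.
by rewrite mevalZ mevalXU mulrC.
Qed.

Lemma subst_subst M N p : subst N (subst M p) = subst (N *m M) p.
Proof.
rewrite /subst comp_mpolyA; congr comp_mpoly; apply: eq_from_tnth => i.
rewrite tnth_map !tnth_mktuple raddf_sum /=.
under eq_bigr => k _ do rewrite -/(subst N _) substZ substX scaler_sumr.
rewrite exchange_big; apply: eq_bigr => k _ /=.
rewrite mxE scaler_suml; apply: eq_bigr => j _.
by rewrite scalerA mulrC.
Qed.

Lemma subst1 p : subst 1%:M p = p.
Proof.
rewrite /subst -[RHS](comp_mpoly_id p); congr comp_mpoly; apply: eq_from_tnth => i.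
rewrite !tnth_mktuple (bigD1 i) //= mxE eqxx scale1r big1 ?addr0 // => k kDi.
by rewrite mxE (negPf kDi) scale0r.
Qed.

Lemma substK M p : M \in unitmx -> subst (invmx M) (subst M p) = p.
Proof. by move=> uM; rewrite subst_subst mulVmx // subst1. Qed.

Lemma substVK M p : M \in unitmx -> subst M (subst (invmx M) p) = p.
Proof. by move=> uM; rewrite subst_subst mulmxV // subst1. Qed.

Lemma mderiv_subst M p k :
  mderiv k (subst M p) = \sum_i M k i *: subst M (mderiv i p).
Proof.
rewrite /subst mderiv_comp_mpoly; apply: eq_bigr => i _.
rewrite tnth_mktuple -mul_mpolyC mulrC; congr (_ * _).
rewrite raddf_sum (bigD1 k) //= mderivZ mderivXU eqxx alg_mpolyC.
by rewrite big1 ?addr0 // => l lDk; rewrite mderivZ mderivXU eq_sym (negPf lDk) scaler0.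
Qed.

Lemma subst_homog M p d : p \is homog d -> subst M p \is homog d.
Proof.
move/dhomogP => hp; rewrite (mpolyE p) raddf_sum /= big_seq.
apply: rpred_sum => m /hp <-; rewrite substZ; apply: rpredZ.
rewrite mpolyXE_id rmorph_prod /=.
have -> : mdeg m = (\sum_(i < 3) m i)%N by rewrite mdegE.
elim/big_ind2: _ => [|p1 d1 p2 d2 h1 h2|i _]; first exact: dhomog1.
  exact: dhomogM.
have h1 : subst M (mpolyX K (mnm1 i)) \is homog 1.
  by rewrite substX; apply: rpred_sum => k _; apply: rpredZ; rewrite dhomogX /= mdeg1.
by rewrite rmorphXn /=; move: (dhomogMn (m i) h1); rewrite mul1n.
Qed.

(** The image of the vector field [v] under the linear map of matrix [M]: its value is multiplied by
    [M], then rewritten in the target coordinates through [invmx M]. *)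
Definition push M v : 'rV[polyS K]_3 :=
  map_mx (subst (invmx M)) (v *m map_mx (@mpolyC 3 K) M).

Lemma pushK M v : M \in unitmx -> push (invmx M) (push M v) = v.
Proof.
move=> uM; apply/rowP => i; rewrite /push mxE invmxK mxE raddf_sum /=.
under eq_bigr => k _ do rewrite rmorphM /= mxE substVK // [map_mx _ (invmx M) _ _]mxE substC.
transitivity ((v *m map_mx (@mpolyC 3 K) M *m map_mx (@mpolyC 3 K) (invmx M)) 0 i).
  by rewrite mxE; apply: eq_bigr => k _; congr (_ * _); rewrite mxE.
by rewrite -mulmxA -map_mxM mulmxV // map_mx1 mulmx1.
Qed.

Lemma push0 M : push M 0 = 0.
Proof. by rewrite /push mul0mx; apply/rowP => i; rewrite !mxE raddf0. Qed.

Lemma push_sum M n (J : {set 'I_n}) (a : 'I_n -> polyS K) (w : 'I_n -> 'rV[polyS K]_3) :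
  push M (\sum_(i in J) a i *: w i) = \sum_(i in J) subst (invmx M) (a i) *: push M (w i).
Proof.
apply/rowP => k; rewrite /push mulmx_suml mxE summxE raddf_sum summxE /=.
by apply: eq_bigr => i _; rewrite -scalemxAl !mxE rmorphM.
Qed.

Lemma push_AR M g v : M \in unitmx -> AR (subst M g) v -> AR g (push M v).
Proof.
move=> uM; rewrite /AR /= => h.
transitivity (subst (invmx M) (\sum_i v 0 i * mderiv i (subst M g))); last first.
  by rewrite h raddf0.
rewrite /push raddf_sum /=.
under eq_bigr => i _ do rewrite mxE mxE raddf_sum mulr_suml /=.
rewrite exchange_big; apply: eq_bigr => i _ /=.
rewrite rmorphM /= mderiv_subst raddf_sum mulr_sumr.
apply: eq_bigr => j _ /=; rewrite substZ substK // mxE rmorphM /= substC.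
by rewrite -mul_mpolyC mulrA.
Qed.

Lemma push_AR_deg M g s v :
  M \in unitmx -> AR_deg (subst M g) s v -> AR_deg g s (push M v).
Proof.
move=> uM [hv dv]; split; first exact: push_AR.
move=> i; rewrite mxE; apply: subst_homog; rewrite mxE.
by apply: rpred_sum => k _; rewrite mxE mulrC mul_mpolyC; apply/rpredZ/dv.
Qed.

(** [push M] is bijective and semilinear over the ring automorphism [subst (invmx M)], so generating
    families correspond in both directions. *)
Lemma push_span M g n (w : 'I_n -> 'rV[polyS K]_3) (J : {set 'I_n}) :
  M \in unitmx ->
  AR (subst M g) = submodule_span w J <->
  AR g = submodule_span (fun i => push M (w i)) J.
Proof.
move=> uM; have uM' : invmx M \in unitmx by rewrite unitmx_inv.
have gE : g = subst (invmx M) (subst M g) by rewrite substK.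
split=> E; apply/seteqP; split=> v.
- rewrite {1}gE => /(push_AR uM'); rewrite E => -[a av].
  exists (fun i => subst (invmx M) (a i)).
  by rewrite -push_sum -av -{1}[M]invmxK pushK.
- case=> a ->.
  rewrite (_ : \sum_(i in J) _ = push M (\sum_(i in J) subst M (a i) *: w i)).
    by apply: (push_AR uM); rewrite E; exists (fun i => subst M (a i)).
  by rewrite push_sum; apply: eq_bigr => i _; rewrite substK.
- move=> /(push_AR uM); rewrite E => -[a av].
  exists (fun i => subst M (a i)); rewrite -[v](pushK v uM) av push_sum invmxK.
  by apply: eq_bigr => i _; rewrite pushK.
- case=> a ->.
  have : AR g (\sum_(i in J) subst (invmx M) (a i) *: push M (w i)).
    by rewrite E; exists (fun i => subst (invmx M) (a i)).
  rewrite {1}gE => /(push_AR uM').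
  by rewrite -push_sum pushK.
Qed.

End Subst.

Section Transfer.
Variable K : numFieldType.
Implicit Types (M : 'M[K]_3) (p g : polyS K).

Lemma AR_generator_degrees_subst M g d : M \in unitmx ->
  AR_generator_degrees (subst M g) d -> AR_generator_degrees g d.
Proof.
move=> uM [sd [w [dw sw minw]]]; split=> //; exists (fun i => push M (w i)).
split=> [i||J]; first exact: push_AR_deg.
  exact/push_span.
by move/push_span => /(_ uM); apply: minw.
Qed.

Lemma free_curve_subst M g : M \in unitmx ->
  free_curve (subst M g) -> free_curve g.
Proof.
move=> uM [m [d [w [dw sw fw]]]]; exists m, d, (fun i => push M (w i)).
split=> [i||a a0 i]; first exact: push_AR_deg.
  exact/push_span.
have uM' : invmx M \in unitmx by rewrite unitmx_inv.
suff : subst M (a i) = 0 by move=> e; rewrite -[a i](substK _ uM) e raddf0.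
move: i; apply: fw.
transitivity (push (invmx M) (\sum_(i in [set: 'I_m]%SET) a i *: push M (w i))).
  rewrite push_sum; apply: eq_big => [i|i _]; first by rewrite finset.in_setT.
  by rewrite invmxK pushK.
by rewrite (eq_bigl predT) => [|i]; rewrite ?finset.in_setT // a0 push0.
Qed.

Lemma AR_deg0 g s : AR_deg g s 0.
Proof.
split=> [|i]; last by rewrite mxE rpred0.
by rewrite /AR /= big1 // => i _; rewrite mxE mul0r.
Qed.

Lemma AR_deg_eq0 g s : (forall v, AR_deg g s v -> v = 0) -> AR_deg g s = [set 0].
Proof.
by move=> h; apply/seteqP; split=> [v /h //|v ->]; apply: AR_deg0.
Qed.

Lemma AR_deg_neq0 g s v : AR_deg g s v -> v != 0 -> AR_deg g s != [set 0].
Proof. by move=> hv v0; apply: contraNneq v0 => E; rewrite E in hv; apply/eqP. Qed.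

Lemma AR_deg_subst_eq0 M g s : M \in unitmx ->
  (AR_deg (subst M g) s == [set 0]) = (AR_deg g s == [set 0]).
Proof.
have H (N : 'M[K]_3) (h : polyS K) : N \in unitmx -> AR_deg (subst N h) s = [set 0] -> AR_deg h s = [set 0].
  move=> uN E; apply: AR_deg_eq0 => v hv.
  have uN' : invmx N \in unitmx by rewrite unitmx_inv.
  have : AR_deg (subst N h) s (push (invmx N) v).
    by apply: push_AR_deg => //; rewrite substK.
  rewrite E => /= v0.
  by rewrite -(pushK v uN') v0 push0.
move=> uM; apply/eqP/eqP; first exact: H.
by rewrite -{1}(substK g uM); apply: H; rewrite unitmx_inv.
Qed.

Lemma mdrE g n : AR_deg g n != [set 0] ->
  (forall t, (t < n)%N -> AR_deg g t = [set 0]) -> mdr g = n.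
Proof.
move=> gn glt; rewrite /mdr; apply: xget_subset1.
  split=> // t; apply: contraR; rewrite -ltnNge => /glt ->; exact: eqxx.
move=> s t [gs ls] [gt lt]; apply/eqP.
by rewrite eqn_leq ls // lt.
Qed.

Lemma mdr_subst M g : M \in unitmx -> mdr (subst M g) = mdr g.
Proof.
move=> uM; have E t : (AR_deg (subst M g) t != [set 0]) = (AR_deg g t != [set 0]).
  by rewrite AR_deg_subst_eq0.
rewrite /mdr; congr (xget _ _); apply/seteqP.
split=> s /= [gs ls]; split=> [|t ht]; try apply: ls.
- by rewrite -E.
- by rewrite E.
- by rewrite E.
- by rewrite -E.
Qed.

End Transfer.

(** * The conic x z = y^2 *)

Section StandardConic.
Variable K : numFieldType.
Implicit Types (p q : polyS K).

Definition std_conic : polyS K := X * Z - Y ^+ 2.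

(* The Veronese parametrisation (x, y, z) = (s^2, s t, t^2), with s and t
   represented by the first two variables. *)
Definition veronese p : polyS K :=
  comp_mpoly [tuple of [:: X ^+ 2; X * Y; Y ^+ 2]] p.

HB.instance Definition _ := GRing.RMorphism.copy veronese
  (comp_mpoly [tuple of [:: (X : polyS K) ^+ 2; X * Y; Y ^+ 2]]).

Lemma veroneseX : [/\ veronese X = X ^+ 2, veronese Y = X * Y & veronese Z = Y ^+ 2].
Proof. by rewrite /veronese !comp_mpolyXU. Qed.

Lemma veroneseZ c p : veronese (c *: p) = c *: veronese p.
Proof. exact: comp_mpolyZ. Qed.

Lemma eval_veronese p (s t u : K) :
  eval (veronese p) (row3 s t u) = eval p (row3 (s ^+ 2) (s * t) (t ^+ 2)).
Proof.
rewrite /veronese comp_mpoly_meval; apply: meval_eq; apply: ord3P;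
  by rewrite mxE /= /tnth /= ?rmorphXn ?rmorphM /= !mevalXU ?mxE.
Qed.

Let mono (i j k : nat) : multinom 3 := Multinom [tuple of [:: i; j; k]].

Let monoE i j k : mpolyX K (mono i j k) = X ^+ i * Y ^+ j * Z ^+ k.
Proof.
rewrite mpolyXE_id !big_ord_recl big_ord0 mulr1 mulrA.
by congr (mpolyX _ (mnm1 _) ^+ _ * mpolyX _ (mnm1 _) ^+ _ * mpolyX _ (mnm1 _) ^+ _);
  apply: val_inj.
Qed.

Let monoP (m : multinom 3) : m = mono (m o0) (m o1) (m o2).
Proof. by apply/mnmP; apply: ord3P; rewrite /mono multinomE. Qed.

Let expr_double (p : polyS K) i : p ^+ i.*2 = (p ^+ 2) ^+ i.
Proof. by rewrite -mul2n exprM. Qed.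

Let ver (m : multinom 3) : multinom 3 :=
  mono ((m o0).*2 + m o1) (m o1 + (m o2).*2) 0.

(** For i + j even, s^i t^j is the image of x^(i/2) z^(j/2), the halves being rounded down and a
    factor y added when i and j are odd. At most one y is kept, since y^2 is x z modulo the
    conic. *)
Let retract (m : multinom 3) : multinom 3 :=
  mono (m o0)./2 (odd (m o0)) (m o1)./2.

Let veroneseXm m : veronese (mpolyX K m) = mpolyX K (ver m).
Proof.
rewrite [in LHS](monoP m) /ver !monoE !rmorphM !rmorphXn /=.
case: veroneseX => -> -> ->; rewrite !exprD !expr_double [(_ * _) ^+ _]exprMn_comm; last exact: mulrC.
by rewrite expr0; ring.
Qed.

Let retract_ver m : exists q, mpolyX K m - mpolyX K (retract (ver m)) = std_conic * q.
Proof.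
rewrite [X in mpolyX K X - _](monoP m) /retract /ver !monoE !multinomE /=.
set i := m o0; set j := m o1; set k := m o2; set h := j./2.
have -> : (i.*2 + j)./2 = (i + h)%N by rewrite halfD odd_double add0n doubleK.
have -> : (j + k.*2)./2 = (h + k)%N by rewrite halfD odd_double andbF add0n doubleK.
rewrite oddD odd_double /= -[in Y ^+ j](odd_double_half j) -/h.
rewrite [X ^+ (i + h)]exprD [Z ^+ (h + k)]exprD [Y ^+ _]exprD expr_double.
(* The two monomials differ by the exchange of (y^2)^h for (x z)^h, and the difference of these
   powers is y^2 - x z times a geometric sum. *)
exists (- (X ^+ i * Y ^+ odd j * Z ^+ k *
         \sum_(l < h) (Y ^+ 2) ^+ (h.-1 - l) * (X * Z) ^+ l)).
have E : (Y ^+ 2 - X * Z : polyS K) * \sum_(l < h) (Y ^+ 2) ^+ (h.-1 - l) * (X * Z) ^+ l =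
    (Y ^+ 2) ^+ h - X ^+ h * Z ^+ h.
  by rewrite -subrXX [(X * Z) ^+ h]exprMn.
have -> : std_conic = - (Y ^+ 2 - X * Z) by rewrite /std_conic opprB.
rewrite mulrNN [RHS]mulrCA E; move: ((Y ^+ 2) ^+ h : polyS K) => y2; ring.
Qed.

(* The linear map induced by [retract] inverts [veronese] modulo the conic. *)
Lemma veronese_eq0 p : veronese p = 0 -> exists q, p = std_conic * q.
Proof.
(* The linear extension [mu] of [retract] is a sum over a finite type of monomials; [b] exceeds the
   degree of every monomial of [veronese p]. *)
move=> p0; pose b := (\max_(m <- msupp p) mdeg (ver m)).+1.
pose mu (q : polyS K) := \sum_(m : bmultinom 3 b) mcoeff m q *: mpolyX K (retract m).
have muX m : (mdeg m < b)%N -> mu (mpolyX K m) = mpolyX K (retract m).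
  move=> mb; rewrite /mu (bigD1 (BMultinom mb)) //= mcoeffX eqxx scale1r.
  rewrite big1 ?addr0 // => m' m'D; rewrite mcoeffX.
  by case: eqP => [mm'|_]; rewrite ?scale0r //; case/eqP: m'D; apply: val_inj.
have E : \sum_(m <- msupp p) mcoeff m p *: mpolyX K (retract (ver m)) = 0.
  transitivity (mu (veronese p)); last first.
    by rewrite p0 /mu big1 // => m _; rewrite mcoeff0 scale0r.
  rewrite [p in RHS]mpolyE /mu raddf_sum /=.
  under [RHS]eq_bigr => m _ do rewrite raddf_sum scaler_suml /=.
  rewrite exchange_big /= !big_seq; apply: eq_bigr => m mp.
  rewrite -muX; last by rewrite ltnS; apply: leq_bigmax_seq.
  rewrite /mu scaler_sumr; apply: eq_bigr => m' _.
  by rewrite veroneseZ veroneseXm mcoeffZ scalerA.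
have {E} -> : p = \sum_(m <- msupp p)
    mcoeff m p *: (mpolyX K m - mpolyX K (retract (ver m))).
  under eq_bigr => m _ do rewrite scalerBr.
  by rewrite sumrB E subr0 -mpolyE.
elim/big_ind: _ => [|p1 p2 [q1 ->] [q2 ->]|m _].
- by exists 0; rewrite mulr0.
- by exists (q1 + q2); rewrite mulrDr.
- by have [q ->] := retract_ver m; exists (mcoeff m p *: q); rewrite scalerAr.
Qed.

End StandardConic.

(** * Local analytic coordinates *)

Section Differential.
Variable K : numFieldType.
Implicit Types (f g : 'rV[K]_2 -> K) (a h : 'rV[K]_2).

(** Bundling the differential with its existence lets the differential of a compound formula be
    found by unification instead of being stated. *)
Definition has_diff f a (df : 'rV[K]_2 -> K) : Prop :=
  differentiable f a /\ forall h, 'd f a h = df h.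

Lemma has_diff_ext f g a df dg : has_diff f a df -> f =1 g -> df =1 dg ->
  has_diff g a dg.
Proof. by move=> hf /funext <- /funext <-. Qed.

Lemma has_diffC c a : has_diff (fun=> c) a (fun=> 0).
Proof.
split=> [|h]; first exact: differentiable_cst.
by rewrite (diff_cst c a).
Qed.

Lemma has_diffD f g a df dg : has_diff f a df -> has_diff g a dg ->
  has_diff (fun q => f q + g q) a (fun h => df h + dg h).
Proof.
move=> [df1 df2] [dg1 dg2]; split=> [|h]; first exact: (differentiableD df1 dg1).
by rewrite (diffD df1 dg1) -df2 -dg2.
Qed.

Lemma has_diffM f g a df dg : has_diff f a df -> has_diff g a dg ->
  has_diff (fun q => f q * g q) a (fun h => f a * dg h + g a * df h).
Proof.
move=> [df1 df2] [dg1 dg2]; split=> [|h]; first exact: (differentiableM df1 dg1).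
rewrite (diffM df1 dg1); by rewrite -df2 -dg2.
Qed.

Lemma has_diffN f a df : has_diff f a df ->
  has_diff (fun q => - f q) a (fun h => - df h).
Proof.
move=> [df1 df2]; split=> [|h]; first exact: (differentiableN df1).
by rewrite (diffN df1) -df2.
Qed.

Lemma has_diffV f a df : f a != 0 -> has_diff f a df ->
  has_diff (fun q => (f q)^-1) a (fun h => - (f a) ^- 2 * df h).
Proof.
move=> fa [df1 df2]; split=> [|h]; first exact: (differentiableV df1 fa).
by rewrite (diffV df1 fa) -df2.
Qed.

Lemma has_diffX f a df n : has_diff f a df ->
  has_diff (fun q => f q ^+ n.+1) a (fun h => n.+1%:R * f a ^+ n * df h).
Proof.
move=> [df1 df2]; rewrite -[X in has_diff X](exprfctE f n.+1).
split=> [|h]; first exact: (differentiableX n df1).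
by rewrite (diffX n df1) -df2.
Qed.

Lemma has_diff_coord k a : has_diff (fun q => q 0 k) a (fun h => h 0 k).
Proof.
have df : differentiable (fun q : 'rV[K]_2 => q 0 k : K) a.
  exact: differentiable_coord.
split=> // h; have @f : {linear 'rV[K]_2 -> K}.
  by exists (fun q : 'rV[K]_2 => q 0 k); do 2![eexists]; do ?[constructor];
     rewrite ?mxE// => ? *; rewrite ?mxE//; move=> ?; rewrite !mxE.
have fc : continuous f by exact: coord_continuous.
by rewrite (_ : (fun _ => _) = f) // (diff_lin a fc).
Qed.

(** A square Jacobian matrix with trivial kernel is invertible, so no determinant is computed: it
    suffices that the two differentials have no common nonzero zero. *)
Lemma local_coordinates_intro f g a df dg : f a = 0 -> g a = 0 ->
  (\forall q \near a, differentiable f q) ->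
  (\forall q \near a, differentiable g q) ->
  has_diff f a df -> has_diff g a dg ->
  (forall h, df h = 0 -> dg h = 0 -> h = 0) ->
  local_coordinates (fun q => \row_j (nth (f q) [:: f q; g q] j : K)) a.
Proof.
move=> fa ga nf ng hf hg inj.
pose e0 : 'rV[K]_2 := delta_mx 0 0; pose e1 : 'rV[K]_2 := delta_mx 0 1.
have -> : (fun q => \row_j (nth (f q) [:: f q; g q] j : K)) =
          (fun q => f q *: e0 + g q *: e1) :> ('rV[K]_2 -> 'rV[K]_2).
  apply/funext => q; apply/rowP => -[[|[|j]] ltj]; rewrite !mxE //=;
  by rewrite ?mulr1 ?mulr0 ?addr0 ?add0r.
have diffphi q : differentiable f q -> differentiable g q ->
    differentiable (fun q => f q *: e0 + g q *: e1) q.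
  by move=> dfq dgq; apply: differentiableD; apply: differentiableZl.
split.
- by rewrite fa ga !scale0r addr0.
- near=> q; apply: diffphi; near: q; assumption.
- rewrite -row_free_unit -kermx_eq0; apply/eqP/row_matrixP => i.
  rewrite row0; set h := row i _.
  have hJ : h *m jacobian (fun q => f q *: e0 + g q *: e1) a = 0.
    by rewrite /h -row_mul mulmx_ker row0.
  have [df1 df2] := hf; have [dg1 dg2] := hg.
  rewrite /jacobian mul_rV_lin1 /= in hJ.
  have E : df h *: e0 + dg h *: e1 = 0.
    have Zl (k : 'rV[K]_2 -> K) (e : 'rV[K]_2) : differentiable k a ->
        'd (fun q => k q *: e) a h = 'd k a h *: e.
      by move=> dk; exact: (congr1 (@^~ h) (diffZl e dk)).
    rewrite -df2 -dg2 -(Zl f e0 df1) -(Zl g e1 dg1) -[RHS]hJ; symmetry.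
    exact: (congr1 (@^~ h) (diffD (differentiableZl e0 df1) (differentiableZl e1 dg1))).
  apply: inj.
    by move/rowP: E => /(_ 0); rewrite !mxE /= mulr1 mulr0 addr0.
  by move/rowP: E => /(_ 1); rewrite !mxE /= mulr1 mulr0 add0r.
Unshelve. all: by end_near.
Qed.

End Differential.

(** * Affine charts and their differentials *)

Section Chart.
Variable K : numFieldType.
Implicit Types (N : 'M[K]_3) (a q h : 'rV[K]_2) (v : 'rV[K]_3) (i : 'I_3).

(** The linear part of the affine map [chart i]. *)
Definition chart_dir i h : 'rV[K]_3 := \row_j oapp (fun k => h 0 k) 0 (unlift i j).

Lemma has_diff_chart i N j a :
  has_diff (fun q => (chart i q *m N) 0 j) a (fun h => (chart_dir i h *m N) 0 j).
Proof.
have dl l : has_diff (fun q => chart i q 0 l) a (fun h => chart_dir i h 0 l).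
  have : has_diff (fun q => oapp (fun k => q 0 k) 1 (unlift i l)) a
                  (fun h => oapp (fun k => h 0 k) 0 (unlift i l)).
    by case: (unlift i l) => [k|] /=; [apply: has_diff_coord|apply: has_diffC].
  by move/has_diff_ext; apply=> q; rewrite mxE.
have dm l := has_diffM (dl l) (has_diffC (N l j) a).
apply: (has_diff_ext (has_diffD (has_diffD (dm o0) (dm o1)) (dm o2))) => q.
  by rewrite [RHS]mxE sum3.
by rewrite [RHS]mxE sum3; ring.
Qed.

(** Directions of the chart have [i]-th entry 0 and [v] does not, so the chart is transverse to the
    line of [v]. *)
Lemma chart_dir_eq0 i v h c : v 0 i != 0 -> chart_dir i h = c *: v -> h = 0.
Proof.
move=> vi E; have c0 : c = 0.
  have /rowP/(_ i) := E; rewrite !mxE unlift_none /= => /esym/eqP.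
  by rewrite mulf_eq0 (negPf vi) orbF => /eqP.
apply/rowP => k; have /rowP/(_ (lift i k)) := E.
by rewrite c0 !mxE liftK mul0r.
Qed.

Lemma chart_exists v : v != 0 -> exists i a c,
  [/\ c != 0, chart i a = c *: v, v 0 i != 0 & (<[chart i a]> = <[v]>)%VS].
Proof.
move=> /rV0Pn [i vi]; exists i, (\row_k ((v 0 i)^-1 * v 0 (lift i k))), (v 0 i)^-1.
have E : chart i (\row_k ((v 0 i)^-1 * v 0 (lift i k))) = (v 0 i)^-1 *: v.
  apply/rowP => j; rewrite !mxE; case: unliftP => [k ->|->] /=; first by rewrite mxE.
  by rewrite mulVf.
split; rewrite ?invr_eq0 //.
rewrite E; apply/eqP; rewrite eqEsubv -!memvE; apply/andP; split.
  by apply: memvZ; apply: memv_line.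
rewrite -{1}[v](scalerKV vi) ; apply: memvZ.
by rewrite memv_line.
Qed.

Lemma near_neq0 (f : 'rV[K]_2 -> K) a : differentiable f a -> f a != 0 ->
  \forall q \near a, f q != 0.
Proof.
move=> /differentiable_continuous fc fa.
exact: (cvgr_neq0 (f a) fc fa).
Qed.

End Chart.

(** * Local normal forms at a common point of the two conics *)

Section Singularities.
Variable K : numClosedFieldType.
Implicit Types (M : 'M[K]_3) (g : polyS K).

(* On the conic, at (s^2, s t, t^2), this is the binary quartic
   a s^3 t + b s^2 t^2 + c s t^3 + d t^4. *)
Definition pencil (l a b c d x y z : K) : K :=
  l * (x * z - y ^+ 2) + a * (x * y) + b * y ^+ 2 + c * (y * z) + d * z ^+ 2.

Definition e100 : 'rV[K]_3 := row3 1 0 0.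

Lemma row3_e100 (w : 'rV[K]_3) : w 0 o1 = 0 -> w 0 o2 = 0 -> w = w 0 o0 *: e100.
Proof.
by move=> w1 w2; apply: row3_eq; rewrite mxE mxE /= ?mulr1 // mulr0.
Qed.

Section Local.
Variables (M : 'M[K]_3) (g : polyS K) (l a b c d : K).
Hypothesis uM : M \in unitmx.
Hypothesis gE : forall x y z, eval g (row3 x y z *m M) =
  (x * z - y ^+ 2) * pencil l a b c d x y z.

Let P := e100 *m M.

Lemma e100M_neq0 : P != 0.
Proof.
apply: contra_neq (oner_neq0 K) => /(congr1 (mulmx^~ (invmx M))).
by rewrite mulmxK // mul0mx => /rowP/(_ o0); rewrite !mxE.
Qed.

Let Lf i q j : K := (chart i q *m invmx M) 0 j.
Let dL i h j : K := (chart_dir i h *m invmx M) 0 j.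

Let dLP i j q : has_diff (fun q => Lf i q j) q (fun h => dL i h j).
Proof. exact: has_diff_chart. Qed.

Let g_chart i q : eval g (chart i q) =
  (Lf i q o0 * Lf i q o2 - Lf i q o1 ^+ 2) *
  pencil l a b c d (Lf i q o0) (Lf i q o1) (Lf i q o2).
Proof.
by rewrite -gE -[in LHS](mulmxKV uM (chart i q)); congr (eval _ (_ *m _)); apply: row3E.
Qed.

Let L_base i q k : chart i q = k *: P ->
  [/\ Lf i q o0 = k, Lf i q o1 = 0 & Lf i q o2 = 0].
Proof. by rewrite /Lf => ->; rewrite -scalemxAl mulmxK // !mxE mulr1 !mulr0. Qed.

Let dL_inj i h : P 0 i != 0 -> dL i h o1 = 0 -> dL i h o2 = 0 -> h = 0.
Proof.
move=> Pi h1 h2; apply: (chart_dir_eq0 (c := dL i h o0) Pi).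
rewrite -[LHS](mulmxKV uM) /P scalemxAl; congr (_ *m _).
by rewrite -row3_e100.
Qed.

(** For nonzero [a] the equations F1 and F2 of the conics have independent differentials at P, so u
    = (F1 + F2)/2 and v = i (F1 - F2)/2 are coordinates, and u^2 + v^2 = F1 F2 with no extra
    unit. *)
Lemma node_singularity : a != 0 -> singularity_A 1 g <[P]>%VS.
Proof.
move=> a0; have [i [p [k [k0 chartp Pi vspE]]]] := chart_exists e100M_neq0.
exists i, p; split=> //.
have [L0 L1 L2] := L_base chartp.
have dF1 q := has_diffD (has_diffM (dLP i o0 q) (dLP i o2 q))
  (has_diffN (has_diffX 1 (dLP i o1 q))).
have dF2 q := has_diffD (has_diffD (has_diffD (has_diffD
  (has_diffM (has_diffC l q) (dF1 q))
  (has_diffM (has_diffC a q) (has_diffM (dLP i o0 q) (dLP i o1 q))))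
  (has_diffM (has_diffC b q) (has_diffX 1 (dLP i o1 q))))
  (has_diffM (has_diffC c q) (has_diffM (dLP i o1 q) (dLP i o2 q))))
  (has_diffM (has_diffC d q) (has_diffX 1 (dLP i o2 q))).
have du q := has_diffM (has_diffC 2^-1 q) (has_diffD (dF1 q) (dF2 q)).
have dv q := has_diffM (has_diffC ('i / 2) q) (has_diffD (dF1 q) (has_diffN (dF2 q))).
eexists; exists (fun=> 1); split.
- apply: (local_coordinates_intro _ _ _ _ (du p) (dv p)).
  + by rewrite /= L0 L1 L2; ring.
  + by rewrite /= L0 L1 L2; ring.
  + by apply: filterE => q; case: (du q).
  + by apply: filterE => q; case: (dv q).
  + move=> h /=; rewrite L0 L1 L2 => hu hv.
    have i2 : 'i ^+ 2 = -1 :> K by exact: sqrCi.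
    have e2 : k * dL i h o2 = 0.
      have := congr2 (fun s t => s - 'i * t) hu hv.
      by move=> /= E; transitivity (0 - 'i * 0 : K); [rewrite -E; field: i2|ring].
    have /eqP := e2; rewrite mulf_eq0 (negPf k0) /= => /eqP d2.
    have e1 : a * k * dL i h o1 = 0.
      by rewrite d2 in hu; have := congr1 ( *%R 2) hu; move=> /= E; transitivity (2 * 0 : K); [rewrite -E; field|ring].
    have /eqP := e1; rewrite !mulf_eq0 (negPf k0) (negPf a0) /= => /eqP d1.
    exact: dL_inj d1 d2.
- by apply: filterE => q; apply: differentiable_cst.
- exact: oner_neq0.
- apply: filterE => q; rewrite !mxE /= mul1r g_chart /pencil.
  have i2 : 'i ^+ 2 = -1 :> K by exact: sqrCi.
  by field: i2.
Qed.

(* On the chart x = 1 put F = z - y^2; the pencil member becomes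
   al F + y^m be with units al and be, so the product of the two conics is
   F (al F + y^m be) = be^2 / (4 al) (u^2 - y^(2m)) for u = 2 al F / be + y^m. *)
Lemma tangency_singularity n m e0 e1 e2 : a = 0 -> l != 0 -> e0 != 0 ->
  (forall y, b * y ^+ 2 + c * y ^+ 3 + d * y ^+ 4 =
    y ^+ m.+2 * (e0 + e1 * y + e2 * y ^+ 2)) ->
  n.+1 = (m.+2 * 2)%N -> singularity_A n g <[P]>%VS.
Proof.
move=> a0 l0 e00 beE nE.
have [i [p [k [k0 chartp Pi vspE]]]] := chart_exists e100M_neq0.
exists i, p; split=> //.
have [L0 L1 L2] := L_base chartp.
(* The coordinate v = zeta y turns the minus sign of u^2 - y^(n+1) into the plus sign that A_n
   requires. *)
have [zeta zetaE] : exists zeta : K, zeta ^+ n.+1 = -1.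
  by exists (n.+1.-root (-1)); rewrite rootCK.
pose y q := Lf i q o1 * (Lf i q o0)^-1.
pose z q := Lf i q o2 * (Lf i q o0)^-1.
pose F q := z q - y q ^+ 2.
(* With z = F + y^2, this is the quotient by F of the difference between the second conic at (1, y,
   z) and at (1, y, y^2). *)
pose al q := l + c * y q + d * (F q + 2 * y q ^+ 2).
pose be q := e0 + e1 * y q + e2 * y q ^+ 2.
pose u q := 2 * al q * F q * (be q)^-1 + y q ^+ m.+2.
pose v q := zeta * y q.
(* The fourth power comes from passing to the chart x = 1 in a form of degree 4. *)
pose e q := Lf i q o0 ^+ 4 * be q ^+ 2 * (4 * al q)^-1.
have dV q (L0q : Lf i q o0 != 0) := has_diffV L0q (dLP i o0 q).
have dy q L0q : has_diff y q _ := has_diffM (dLP i o1 q) (dV q L0q).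
have dz q L0q : has_diff z q _ := has_diffM (dLP i o2 q) (dV q L0q).
have dF q L0q : has_diff F q _ := has_diffD (dz q L0q) (has_diffN (has_diffX 1 (dy q L0q))).
have dal q L0q : has_diff al q _ := has_diffD (has_diffD (has_diffC l q)
  (has_diffM (has_diffC c q) (dy q L0q))) (has_diffM (has_diffC d q)
  (has_diffD (dF q L0q) (has_diffM (has_diffC 2 q) (has_diffX 1 (dy q L0q))))).
have dbe q L0q : has_diff be q _ := has_diffD (has_diffD (has_diffC e0 q)
  (has_diffM (has_diffC e1 q) (dy q L0q))) (has_diffM (has_diffC e2 q)
  (has_diffX 1 (dy q L0q))).
have du q L0q beq : has_diff u q _ := has_diffD (has_diffM (has_diffM (has_diffM
  (has_diffC 2 q) (dal q L0q)) (dF q L0q)) (has_diffV beq (dbe q L0q)))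
  (has_diffX m.+1 (dy q L0q)).
have dv q L0q : has_diff v q _ := has_diffM (has_diffC zeta q) (dy q L0q).
have L0p : Lf i p o0 != 0 by rewrite L0.
have yp : y p = 0 by rewrite /y L1 mul0r.
have zp : z p = 0 by rewrite /z L2 mul0r.
have Fp : F p = 0 by rewrite /F zp yp; ring.
have alp : al p = l by rewrite /al Fp yp; ring.
have bep : be p = e0 by rewrite /be yp; ring.
have nL0 : \forall q \near p, Lf i q o0 != 0 := near_neq0 (dLP i o0 p).1 L0p.
have nal : \forall q \near p, al q != 0.
  by apply: near_neq0; [case: (dal p L0p)|rewrite alp].
have nbe : \forall q \near p, be q != 0.
  by apply: near_neq0; [case: (dbe p L0p)|rewrite bep].
have beq : be p != 0 by rewrite bep.
eexists; exists e; split.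
- apply: (local_coordinates_intro _ _ _ _ (du p L0p beq) (dv p L0p)).
  + by rewrite /u Fp yp exprS; ring.
  + by rewrite /v yp mulr0.
  + by near=> q; case: (du q _ _) => //; near: q.
  + by near=> q; case: (dv q _) => //; near: q.
  + move=> h /=; rewrite L0 L1 L2 yp Fp alp bep => hu hv.
    have z0 : zeta != 0.
      by apply: contra_eq_neq zetaE => ->; rewrite expr0n eq_sym oppr_eq0 oner_neq0.
    have d1 : dL i h o1 = 0.
      have : zeta * k^-1 * dL i h o1 = 0 by rewrite -[RHS]hv; field.
      by move/eqP; rewrite !mulf_eq0 invr_eq0 (negPf z0) (negPf k0) => /eqP.
    have d2 : dL i h o2 = 0.
      (* The power y^(m+2) has order at least 2, so at P the differential of u is 2 l / e0 times
         that of F. *)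
      have : 2 * l / e0 / k * dL i h o2 = 0.
        by rewrite -[RHS]hu exprS d1; field; rewrite k0 e00.
      move/eqP; rewrite !mulf_eq0 !invr_eq0 (negPf l0) (negPf e00) (negPf k0).
      by rewrite pnatr_eq0 => /eqP.
    exact: dL_inj d1 d2.
- near=> q.
  have L0q : Lf i q o0 != 0 by near: q.
  have alq : 4 * al q != 0 by rewrite mulf_neq0 ?pnatr_eq0 //; near: q.
  have de := has_diffM (has_diffM (has_diffX 3 (dLP i o0 q)) (has_diffX 1 (dbe q L0q)))
    (has_diffV alq (has_diffM (has_diffC 4 q) (dal q L0q))).
  exact: de.1.
- rewrite /e bep alp L0 !mulf_neq0 ?invr_eq0 ?mulf_neq0 ?expf_neq0 ?pnatr_eq0 //.
- near=> q; rewrite !mxE /= g_chart /pencil a0 nE.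
  have L0q : Lf i q o0 != 0 by near: q.
  have alq : al q != 0 by near: q.
  have beq' : be q != 0 by near: q.
  have y1 : Lf i q o1 = Lf i q o0 * y q by rewrite /y; field.
  have z1 : Lf i q o2 = Lf i q o0 * (F q + y q ^+ 2) by rewrite /F /z; field.
  have vE : v q ^+ (m.+2 * 2) = - (y q ^+ m.+2) ^+ 2.
    by rewrite /v exprMn -nE zetaE nE exprM mulN1r.
  have yE := beE (y q); rewrite -/(be q) in yE.
  rewrite vE /u /e y1 z1.
  move: yE; rewrite /pencil; set ym := y q ^+ m.+2 => yE.
  transitivity (Lf i q o0 ^+ 4 * F q * (al q * F q + ym * be q)); last first.
    by field; rewrite ?alq ?beq'.
  by rewrite -yE /al; ring.
Unshelve. all: by end_near.
Qed.
End Local.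
End Singularities.

(** * Jacobian syzygies of a pair of conics in normal form *)

Section Coefficients.
Variable K : numFieldType.

Lemma natf_mul_eq0 n (x : K) : n.+1%:R * x = 0 -> x = 0.
Proof. by move/eqP; rewrite mulf_eq0 pnatr_eq0 => /eqP. Qed.

Lemma lincomb_eq0 (R : pzRingType) (c d u v x : R) :
  u = 0 -> v = 0 -> x = c * u + d * v -> x = 0.
Proof. by move=> -> -> ->; rewrite !mulr0 addr0. Qed.

Lemma quartic_coef (A B C D E : K) :
  (forall s t, A * s ^+ 4 + B * (s ^+ 3 * t) + C * (s ^+ 2 * t ^+ 2) +
     D * (s * t ^+ 3) + E * t ^+ 4 = 0) ->
  [/\ A = 0, B = 0, C = 0, D = 0 & E = 0].
Proof.
move=> h.
have A0 : A = 0 by rewrite -[RHS](h 1 0); ring.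
have E0 : E = 0 by rewrite -[RHS](h 0 1); ring.
rewrite A0 E0 in h *; have h1 := h 1 1; have h2 := h 1 (-1); have h3 := h 1 2.
have C0 : C = 0.
  by apply: (@natf_mul_eq0 1); apply: (lincomb_eq0 (c := 1) (d := 1) h1 h2); ring.
have D0 : D = 0.
  by apply: (@natf_mul_eq0 5); apply: (lincomb_eq0 (c := -2) (d := 1) h1 h3); rewrite C0; ring.
split=> //; apply: (lincomb_eq0 (c := 1) (d := 0) h1 h1); rewrite C0 D0; ring.
Qed.

Lemma quadratic_coef (A B C D E F : K) :
  (forall x y z, A * x ^+ 2 + B * y ^+ 2 + C * z ^+ 2 +
     D * (x * y) + E * (y * z) + F * (x * z) = 0) ->
  [/\ A = 0, B = 0 & C = 0] /\ [/\ D = 0, E = 0 & F = 0].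
Proof.
move=> h.
have A0 : A = 0 by rewrite -[RHS](h 1 0 0); ring.
have B0 : B = 0 by rewrite -[RHS](h 0 1 0); ring.
have C0 : C = 0 by rewrite -[RHS](h 0 0 1); ring.
rewrite A0 B0 C0 in h *; split; split=> //.
- by rewrite -[RHS](h 1 1 0); ring.
- by rewrite -[RHS](h 0 1 1); ring.
- by rewrite -[RHS](h 1 0 1); ring.
Qed.

End Coefficients.

(** * Derivations and divisibility by a variable *)

Section Derivation.
Variable K : numFieldType.
Implicit Types (p q g : polyS K) (v w : 'rV[polyS K]_3).

(** The vector field [v] as a derivation: [AR g] consists of those killing [g], and the Leibniz rule
    applies to the product of the conics. *)
Definition dirD v p : polyS K := \sum_(i < 3) v 0 i * mderiv i p.

Lemma ARE g v : AR g v <-> dirD v g = 0. Proof. by []. Qed.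

Lemma dirDD v p q : dirD v (p + q) = dirD v p + dirD v q.
Proof. by rewrite -big_split; apply: eq_bigr => i _; rewrite linearD mulrDr. Qed.

Lemma dirDN v p : dirD v (- p) = - dirD v p.
Proof. by rewrite -sumrN; apply: eq_bigr => i _; rewrite linearN mulrN. Qed.

Lemma dirDM v p q : dirD v (p * q) = dirD v p * q + p * dirD v q.
Proof.
rewrite mulr_suml mulr_sumr -big_split; apply: eq_bigr => i _.
by rewrite mderivM /=; ring.
Qed.

Lemma dirDC v c : dirD v (mpolyC 3 c) = 0.
Proof. by rewrite /dirD big1 // => i _; rewrite mderivC mulr0. Qed.

Lemma dirDX v i : dirD v (mpolyX K (mnm1 i)) = v 0 i.
Proof.
rewrite /dirD (bigD1 i) //= mderivXU eqxx mulr1 big1 ?addr0 // => l lDi.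
by rewrite mderivXU (negPf lDi) mulr0.
Qed.

Lemma dirDXn v i : dirD v (mpolyX K (mnm1 i) ^+ 2) = 2 * mpolyX K (mnm1 i) * v 0 i.
Proof. by rewrite expr2 dirDM dirDX; ring. Qed.

Lemma dirD_sum n (J : {set 'I_n}) (a : 'I_n -> polyS K) (w : 'I_n -> 'rV[polyS K]_3) p :
  dirD (\sum_(i in J) a i *: w i) p = \sum_(i in J) a i * dirD (w i) p.
Proof.
rewrite /dirD.
under eq_bigr => k _ do rewrite summxE mulr_suml.
rewrite exchange_big; apply: eq_bigr => i _; rewrite mulr_sumr.
by apply: eq_bigr => k _; rewrite mxE mulrA.
Qed.

Lemma span_sub_AR g n (w : 'I_n -> 'rV[polyS K]_3) (J : {set 'I_n}) :
  (forall i, AR g (w i)) -> submodule_span w J `<=` AR g.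
Proof.
move=> hw v [a ->]; apply/ARE; rewrite dirD_sum big1 // => i _.
by rewrite (ARE _ _).1 ?mulr0.
Qed.

(** Reduction modulo a variable, kept inside the same polynomial ring. *)
Definition kill (i : 'I_3) p : polyS K :=
  comp_mpoly [tuple if j == i then 0 else mpolyX K (mnm1 j) | j < 3] p.

HB.instance Definition _ i := GRing.RMorphism.copy (kill i)
  (comp_mpoly [tuple if j == i then 0 else mpolyX K (mnm1 j) | j < 3]).

Lemma killX i j : kill i (mpolyX K (mnm1 j)) = if j == i then 0 else mpolyX K (mnm1 j).
Proof. by rewrite /kill comp_mpolyXU -tnth_nth tnth_mktuple. Qed.

Lemma killC i c : kill i (mpolyC 3 c) = mpolyC 3 c.
Proof. exact: comp_mpolyC. Qed.

Lemma eval_kill i p (u : 'rV[K]_3) : u 0 i = 0 -> eval (kill i p) u = eval p u.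
Proof.
move=> ui; rewrite /kill comp_mpoly_meval; apply: meval_eq => j.
by rewrite tnth_mktuple; case: eqP => [->|_]; rewrite ?meval0 ?mevalXU.
Qed.

Lemma kill_decomp i p : exists q, p = mpolyX K (mnm1 i) * q + kill i p.
Proof.
elim/mpoly_ring_ind: p => [c|j|p p' [q Hp] [q' Hp']|p p' [q Hp] [q' Hp']].
- by exists 0; rewrite killC mulr0 add0r.
- rewrite killX; case: eqP => [->|_].
    by exists 1; rewrite mulr1 addr0.
  by exists 0; rewrite mulr0 add0r.
- exists (q + q'); rewrite raddfD /= {1}Hp {1}Hp'; ring.
- exists (q * p' + kill i p * q').
  rewrite rmorphM /= {1}Hp [in LHS]Hp'; set T := kill i p; set T' := kill i p'.
  by rewrite [in RHS]Hp' -/T'; ring.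
Qed.

(** The variable is prime, and the point [u] certifies that it does not divide [q]. *)
Lemma dvd_var i p q r (u : 'rV[K]_3) : u 0 i = 0 -> eval q u != 0 ->
  mpolyX K (mnm1 i) * p = q * r -> exists r', r = mpolyX K (mnm1 i) * r'.
Proof.
move=> ui qu /(congr1 (kill i)); rewrite !rmorphM /= killX eqxx mul0r => /esym/eqP.
rewrite mulf_eq0 => /orP[/eqP q0|/eqP r0].
  by rewrite -(eval_kill _ ui) q0 meval0 eqxx in qu.
by have [r' {1}->] := kill_decomp i r; exists r'; rewrite r0 addr0.
Qed.

Lemma mpolyX_neq0 i : mpolyX K (mnm1 i) != 0 :> polyS K.
Proof. by rewrite -msize_poly_eq0 msizeX. Qed.

Lemma proportional_var i j p q : i != j ->
  mpolyX K (mnm1 i) * p = mpolyX K (mnm1 j) * q ->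
  exists r, p = mpolyX K (mnm1 j) * r /\ q = mpolyX K (mnm1 i) * r.
Proof.
move=> iDj E.
have [r qE] : exists r, q = mpolyX K (mnm1 i) * r.
  apply: (dvd_var (u := delta_mx 0 j) _ _ E); first by rewrite mxE (negPf iDj) andbF.
  by rewrite mevalXU mxE !eqxx oner_neq0.
exists r; split=> //; apply: (mulfI (mpolyX_neq0 i)).
by rewrite E qE; ring.
Qed.

End Derivation.

Section Pencil.
Variable K : numFieldType.
Implicit Types (v w : 'rV[polyS K]_3) (l a b c d : K).
Local Notation Q := (std_conic K).

(** Any quadratic form vanishing at (1:0:0), with x z absorbed into the multiple of the first conic,
    so that the other four coefficients are those of the restriction to that conic. *)
Definition pencil_mpoly l a b c d : polyS K :=
  pC l * Q + pC a * (X * Y) + pC b * Y ^+ 2 + pC c * (Y * Z) + pC d * Z ^+ 2.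

Lemma eval_std_conic (x y z : K) : eval Q (row3 x y z) = x * z - y ^+ 2.
Proof. by rewrite /std_conic mevalB mevalM rmorphXn /= !mevalXU !mxE. Qed.

Lemma eval_pencil l a b c d (x y z : K) : eval (pencil_mpoly l a b c d) (row3 x y z) =
  l * (x * z - y ^+ 2) + a * (x * y) + b * y ^+ 2 + c * (y * z) + d * z ^+ 2.
Proof.
rewrite /pencil_mpoly !mevalD !mevalM !mevalC eval_std_conic ?expr2.
by rewrite !mevalXU !mxE.
Qed.

Lemma std_conic_neq0 : Q != 0.
Proof.
apply/eqP => /(congr1 (fun p => eval p (row3 1 0 1 : 'rV[K]_3))).
rewrite eval_std_conic meval0 => /eqP; rewrite (_ : _ - _ = 1) ?oner_eq0 //; ring.
Qed.

Lemma dirD_std_conic v : dirD v Q = v 0 o0 * Z + v 0 o2 * X - 2 * Y * v 0 o1.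
Proof. by rewrite /std_conic dirDD dirDN dirDM dirDXn !dirDX; ring. Qed.

Lemma dirD_pencil l a b c d v : dirD v (pencil_mpoly l a b c d) =
  pC l * (v 0 o0 * Z + v 0 o2 * X - 2 * Y * v 0 o1) +
  pC a * (v 0 o0 * Y + v 0 o1 * X) + 2 * pC b * Y * v 0 o1 +
  pC c * (v 0 o1 * Z + v 0 o2 * Y) + 2 * pC d * Z * v 0 o2.
Proof.
rewrite /pencil_mpoly !dirDD !dirDM !dirDC !dirDX dirD_std_conic; ring.
Qed.

Lemma veronese_std_conic : veronese Q = 0.
Proof.
rewrite /std_conic rmorphB rmorphM rmorphXn /=.
by case: (veroneseX K) => -> -> ->; ring.
Qed.

Lemma veronese_pencil_eq0 l a b c d : veronese (pencil_mpoly l a b c d) = 0 ->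
  [/\ a = 0, b = 0, c = 0 & d = 0].
Proof.
move=> E; suff [] : [/\ 0 = 0 :> K, a = 0, b = 0, c = 0 & d = 0] by [].
apply: quartic_coef => s t.
transitivity (eval (veronese (pencil_mpoly l a b c d)) (row3 s t 0)).
  by rewrite eval_veronese eval_pencil; ring.
by rewrite E meval0.
Qed.

(* The conic Q is prime and does not divide f2, hence a derivation killing
   Q * f2 preserves the ideals of both factors. *)
Lemma AR_split (f2 : polyS K) v : veronese f2 != 0 -> AR (Q * f2) v ->
  veronese (dirD v Q) = 0 /\
  exists h, dirD v Q = Q * h /\ dirD v f2 = - f2 * h.
Proof.
move=> f20 /ARE; rewrite dirDM => E.
have Dv0 : veronese (dirD v Q) = 0.
  have := congr1 (@veronese K) E; rewrite rmorphD !rmorphM /= veronese_std_conic.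
  by rewrite mul0r addr0 raddf0 => /eqP; rewrite mulf_eq0 (negPf f20) orbF => /eqP.
split=> //; have [h hE] := veronese_eq0 Dv0; exists h; split=> //.
apply: (mulfI std_conic_neq0); rewrite hE in E.
by move/eqP: E; rewrite addrC addr_eq0 => /eqP ->; ring.
Qed.

Lemma homog0_const (p : polyS K) : p \is homog 0 -> exists k, p = pC k.
Proof.
move/dhomogP => hp; exists (mcoeff mnm0 p); apply/mpolyP => m.
rewrite mcoeffC; case: eqP => [->|m0]; first by rewrite mulr1.
rewrite mulr0; apply: memN_msupp_eq0; apply/negP => /hp /eqP.
by rewrite mdeg_eq0 => /eqP.
Qed.

Lemma homog1_linear (p : polyS K) : p \is homog 1 ->
  exists k0 k1 k2, p = pC k0 * X + pC k1 * Y + pC k2 * Z.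
Proof.
move/dhomogP => hp; rewrite (mpolyE p) big_seq.
elim/big_ind: _ => [|p1 p2 [i0 [i1 [i2 ->]]] [j0 [j1 [j2 ->]]]|m /hp /eqP].
- by exists 0, 0, 0; rewrite !mpolyC0; ring.
- by exists (i0 + j0), (i1 + j1), (i2 + j2); rewrite !mpolyCD; ring.
rewrite mdeg_eq1 => /existsP [i /eqP ->]; rewrite -mul_mpolyC; set k := mcoeff _ _.
move: i @k; apply: ord3P => k.
- by exists k, 0, 0; rewrite !mpolyC0; ring.
- by exists 0, k, 0; rewrite !mpolyC0; ring.
- by exists 0, 0, k; rewrite !mpolyC0; ring.
Qed.

Lemma veronese_dirD v (s t : K) : veronese (dirD v Q) = 0 ->
  let u := row3 (s ^+ 2) (s * t) (t ^+ 2) in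
  eval (v 0 o0) u * t ^+ 2 + eval (v 0 o2) u * s ^+ 2 - 2 * (s * t) * eval (v 0 o1) u = 0.
Proof.
move=> E u; transitivity (eval (veronese (dirD v Q)) (row3 s t 0)); last by rewrite E meval0.
rewrite eval_veronese dirD_std_conic -/u mevalB mevalD !mevalM !mevalXU !mxE /=.
by rewrite rmorph_nat.
Qed.

Lemma AR_deg0_pencil l a b c d :
  veronese (pencil_mpoly l a b c d) != 0 -> AR_deg (Q * pencil_mpoly l a b c d) 0 = [set 0].
Proof.
move=> f20; apply: AR_deg_eq0 => v [/(AR_split f20) [E _] hv].
have [k0 v0] := homog0_const (hv o0); have [k1 v1] := homog0_const (hv o1).
have [k2 v2] := homog0_const (hv o2).
have [k20 k10 k00 _ _] : [/\ k2 = 0, - (2 * k1) = 0, k0 = 0, 0 = 0 :> K & 0 = 0 :> K].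
  apply: quartic_coef => s t; have := veronese_dirD s t E.
  (* A constant field gives a binary quadratic form; the factor s^2 makes it the quartic that
     [quartic_coef] expects. *)
  by rewrite /= v0 v1 v2 !mevalC => /(congr1 ( *%R (s ^+ 2))); rewrite mulr0 => e; apply: etrans e; ring.
have k1' : k1 = 0 by apply: (@natf_mul_eq0 _ 1); rewrite -[RHS]oppr0 -k10 opprK.
by apply: row3_eq; rewrite mxE ?v0 ?v1 ?v2 ?k00 ?k1' ?k20 mpolyC0.
Qed.

(** The linear fields preserving the conic are the Euler field ([m]) and the image of sl_2 acting on
    the parameters s and t ([p] and [q] nilpotent, [r] diagonal). For them v Q = 2 m Q, so the
    second conic must satisfy v f2 = - 2 m f2. *)
Lemma AR_deg1_pencil l a b c d :
  veronese (pencil_mpoly l a b c d) != 0 ->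
  forall v, AR_deg (Q * pencil_mpoly l a b c d) 1 v ->
  exists m p q r,
    v = row3 (pC (m + r) * X + pC (2 * p) * Y) (pC q * X + pC m * Y + pC p * Z)
             (pC (2 * q) * Y + pC (m - r) * Z) /\
    forall x y z, eval (dirD v (pencil_mpoly l a b c d)) (row3 x y z) +
       2 * m * eval (pencil_mpoly l a b c d) (row3 x y z) = 0.
Proof.
move=> f20 v [AR_v hv]; have [E [h [Ev Eh]]] := AR_split f20 AR_v.
have [k0 [i0 [j0 v0]]] := homog1_linear (hv o0).
have [k1 [i1 [j1 v1]]] := homog1_linear (hv o1).
have [k2 [i2 [j2 v2]]] := homog1_linear (hv o2).
have [k20 q0 r0 p0 j00] : [/\ k2 = 0, i2 - 2 * k1 = 0, k0 + j2 - 2 * i1 = 0,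
    i0 - 2 * j1 = 0 & j0 = 0].
  apply: quartic_coef => s t; have := veronese_dirD s t E.
  rewrite /= v0 v1 v2 !mevalD !mevalM !mevalC !mevalXU !mxE /= => e; apply: etrans e; ring.
have i2E : i2 = 2 * k1 by rewrite -[LHS]subr0 -q0; ring.
have i0E : i0 = 2 * j1 by rewrite -[LHS]subr0 -p0; ring.
have j2E : j2 = 2 * i1 - k0 by rewrite -[LHS]subr0 -r0; ring.
subst k2 j0 i2 i0 j2.
exists i1, j1, k1, (k0 - i1); split.
  apply: row3_eq; rewrite mxE /= ?v0 ?v1 ?v2.
  - by rewrite mpolyC0 (_ : i1 + (k0 - i1) = k0); ring.
  - by [].
  - by rewrite mpolyC0 (_ : i1 - (k0 - i1) = 2 * i1 - k0); ring.
have DQ : dirD v Q = Q * pC (2 * i1).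
  rewrite dirD_std_conic v0 v1 v2 /std_conic mpolyC0 !mpolyCM !mpolyCB !mpolyCM.
  rewrite mpolyC_nat; ring.
have hE : h = pC (2 * i1) by apply: (mulfI std_conic_neq0); rewrite -Ev.
by move=> x y z; rewrite Eh hE mevalM mevalN mevalC; ring.
Qed.

End Pencil.

(** * Absence of linear syzygies *)

Section LinearSyzygies.
Variable K : numFieldType.
Implicit Types (v w : 'rV[polyS K]_3) (l a b c d : K).
Local Notation Q := (std_conic K).

(** The premise lists the coefficients of x^2, y^2, z^2, then of x y, y z, x z in v f2 + 2 m f2 = 0:
    a linear system in the four parameters of a linear field preserving the first conic. *)
Lemma AR_deg1_coef l a b c d :
  veronese (pencil_mpoly l a b c d) != 0 ->
  (forall m p q r : K, [/\ a * q = 0, -4 * l * m + 2 * p * a + 4 * b * m + 2 * c * q = 0 &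
       c * p + 2 * d * (m - r) + 2 * m * d = 0] ->
     [/\ a * (4 * m + r) + 2 * b * q = 0, 2 * b * p + c * (4 * m - r) + 4 * d * q = 0 &
       4 * l * m + a * p + c * q = 0] -> [/\ m = 0, p = 0, q = 0 & r = 0]) ->
  AR_deg (Q * pencil_mpoly l a b c d) 1 = [set 0].
Proof.
move=> f20 H; apply: AR_deg_eq0 => v /(AR_deg1_pencil f20) [m [p [q [r [vE E]]]]].
have [] := quadratic_coef (A := a * q)
  (B := -4 * l * m + 2 * p * a + 4 * b * m + 2 * c * q)
  (C := c * p + 2 * d * (m - r) + 2 * m * d)
  (D := a * (4 * m + r) + 2 * b * q)
  (E := 2 * b * p + c * (4 * m - r) + 4 * d * q)
  (F := 4 * l * m + a * p + c * q).
  move=> x y z; apply: etrans (E x y z); rewrite eval_pencil dirD_pencil vE.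
  rewrite !mxE /= !(mevalD, mevalN, mevalM) !mevalC !mevalXU !mxE /= ?rmorph_nat.
  ring.
move=> h1 h2; case: (H m p q r h1 h2) => m0 p0 q0 r0.
rewrite vE m0 p0 q0 r0.
by apply: row3_eq; rewrite !mxE /= ?addr0 ?subr0 ?mulr0 ?mpolyC0 ?mul0r ?addr0.
Qed.

Lemma AR_deg1_nodal l a b c : a != 0 -> c != 0 ->
  AR_deg (Q * pencil_mpoly l a b c 0) 1 = [set 0].
Proof.
move=> a0 c0; have f20 : veronese (pencil_mpoly l a b c 0) != 0.
  by apply/eqP => /veronese_pencil_eq0 [ae]; rewrite ae eqxx in a0.
have cancel k x : k != 0 -> k * x = 0 -> x = 0 :> K.
  by move=> k0 /eqP; rewrite mulf_eq0 (negPf k0) => /eqP.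
apply: (AR_deg1_coef f20) => m p q r [/(cancel _ _ a0) q0 _ hp] [hxy hyz _].
have p0 : p = 0 by apply: (cancel _ _ c0); rewrite -[RHS]hp; ring.
have h1 : 4 * m + r = 0 by apply: (cancel _ _ a0); rewrite -[RHS]hxy q0; ring.
have h2 : 4 * m - r = 0 by apply: (cancel _ _ c0); rewrite -[RHS]hyz p0; ring.
have m0 : m = 0.
  apply: (@natf_mul_eq0 _ 7); apply: (lincomb_eq0 (c := 1) (d := 1) h1 h2); ring.
by split=> //; rewrite -[RHS]h1 m0; ring.
Qed.

Lemma AR_deg1_tangent l b c : c != 0 -> l != 0 ->
  AR_deg (Q * pencil_mpoly l 0 b c 0) 1 = [set 0].
Proof.
move=> c0 l0; have f20 : veronese (pencil_mpoly l 0 b c 0) != 0.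
  by apply/eqP => /veronese_pencil_eq0 [_ _ ce]; rewrite ce eqxx in c0.
have cancel k x : k != 0 -> k * x = 0 -> x = 0 :> K.
  by move=> k0 /eqP; rewrite mulf_eq0 (negPf k0) => /eqP.
apply: (AR_deg1_coef f20) => m p q r [_ hyy hp] [hxy hyz hxz].
have p0 : p = 0 by apply: (cancel _ _ c0); rewrite -[RHS]hp; ring.
have q0 : q = 0.
  (* If [b] is nonzero the coefficient of x y gives [q = 0]; at a contact of order 3 that
     coefficient is void, and those of y^2 and x z add up to 3 c q. *)
  have [b0|b0] := eqVneq b 0; last first.
    by apply: (cancel _ _ b0); apply: (@natf_mul_eq0 _ 1); rewrite -[RHS]hxy; ring.
  apply: (cancel _ _ c0); apply: (@natf_mul_eq0 _ 2).
  by apply: (lincomb_eq0 (c := 1) (d := 1) hyy hxz); rewrite b0 p0; ring.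
have m0 : m = 0.
  apply: (cancel _ _ l0); apply: (@natf_mul_eq0 _ 3).
  by rewrite -[RHS]hxz q0; ring.
split=> //; apply: (cancel _ _ c0).
have : - (c * r) = 0 by rewrite -[RHS]hyz p0 q0 m0; ring.
by move/eqP; rewrite oppr_eq0 => /eqP.
Qed.

End LinearSyzygies.

Section Homogeneity.
Variable K : numFieldType.
Implicit Types (p q : polyS K).

Lemma homogX (i : 'I_3) : mpolyX K (mnm1 i) \is homog 1.
Proof. by rewrite dhomogX /= mdeg1. Qed.

Lemma homogC (c : K) : mpolyC 3 c \is homog 0.
Proof. by rewrite -alg_mpolyC; apply/rpredZ/dhomog1. Qed.

Lemma homog_nat n : (n%:R : polyS K) \is homog 0.
Proof. by rewrite -mpolyC_nat homogC. Qed.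

Lemma homogD n p q : p \is homog n -> q \is homog n -> p + q \is homog n.
Proof. exact: rpredD. Qed.

Lemma homogN n p : p \is homog n -> - p \is homog n.
Proof. by rewrite rpredN. Qed.

Lemma homogM n d e p q : p \is homog d -> q \is homog e -> (d + e)%N = n ->
  p * q \is homog n.
Proof. by move=> hp hq <-; apply: dhomogM. Qed.

Lemma homogXn n d k p : p \is homog d -> (d * k)%N = n -> p ^+ k \is homog n.
Proof. by move=> hp <-; apply: dhomogMn. Qed.

Lemma homog_std_conic : std_conic K \is homog 2.
Proof.
apply: homogD; first exact: (homogM (homogX _) (homogX _)).
exact/homogN/(homogXn (homogX _)).
Qed.

End Homogeneity.

Ltac homogeneous := first
  [ exact (homogX _ _) | exact (homogC _) | exact (homog_nat _ _)
  | exact (homog_std_conic _) | eassumption | exact: rpred0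
  | refine (homogD _ _); [homogeneous | homogeneous]
  | refine (homogN _); homogeneous
  | refine (homogXn _ _); [homogeneous | reflexivity]
  | refine (homogM _ _ _); [homogeneous | homogeneous | reflexivity] ].

(** * Generators for two tacnodes *)

Section Generators.
Variable K : numFieldType.
Implicit Types (v w : 'rV[polyS K]_3) (l a b c d : K).
Local Notation Q := (std_conic K).

(** A generating subset missing [i] would express [w i] by the others; extending its coefficients by
    0 gives a relation with [a i = 0]. *)
Lemma irredundant g n (w : 'I_n -> 'rV[polyS K]_3) :
  (forall i, AR g (w i)) ->
  (forall i (a : 'I_n -> polyS K), a i = 0 -> w i = \sum_j a j *: w j -> False) ->
  forall J : {set 'I_n}, AR g = submodule_span w J -> J = [set: 'I_n]%SET.
Proof.
move=> ARw irr J E; apply/eqP; rewrite -finset.subTset; apply/fintype.subsetP => i _.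
apply/negPn/negP => iJ; have := ARw i; rewrite E => -[a ai].
apply: (irr i (fun j => if j \in J then a j else 0)); first by rewrite (negPf iJ).
rewrite {1}ai big_mkcond; apply: eq_bigr => j _.
by case: (j \in J); rewrite ?scale0r.
Qed.

Lemma span3 (w : 'I_3 -> 'rV[polyS K]_3) v (a0 a1 a2 : polyS K) :
  v = a0 *: w o0 + a1 *: w o1 + a2 *: w o2 -> submodule_span w [set: 'I_3]%SET v.
Proof.
move=> ->; exists (fun i => nth 0 [:: a0; a1; a2] i).
rewrite (eq_bigl predT) => [|i]; last by rewrite finset.in_setT.
by rewrite sum3.
Qed.

Section TwoTacnodes.
Variables l b : K.
Hypotheses (l0 : l != 0) (b0 : b != 0) (lDb : l != b).
Local Notation L := (mpolyC 3 l).
Local Notation B := (mpolyC 3 b).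

(** [T1] is l Q + f2, the factor of - h when v Q = h Q is inserted into v f2 = - h f2. [T] is what
    remains of v Q = h Q, scaled by b, once the middle component is eliminated. *)
Let T1 : polyS K := 2 * L * Q + B * Y ^+ 2.
Let T : polyS K := T1 - B * Q.

(** The first field generates the diagonal torus fixing both x z and y^2. The other two solve 2 b
    v_1 = T1 k and b (v_0 z + v_2 x) = y T k for k = x and k = z, up to a constant factor. *)
Definition two_tacnodes_gen : seq 'rV[polyS K]_3 :=
  [:: row3 X 0 (- Z); row3 0 (- (X * T1)) (- (2 * Y * T));
      row3 (- (2 * Y * T)) (- (Z * T1)) 0].

Let w (i : 'I_3) := nth 0 two_tacnodes_gen i.
Let g : polyS K := Q * pencil_mpoly l 0 b 0 0.

Let hf2 : veronese (pencil_mpoly l 0 b 0 0) != 0.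
Proof. by apply/eqP => /veronese_pencil_eq0 [_ be]; have := b0; rewrite be eqxx. Qed.

Lemma two_tacnodes_gen_deg (i : 'I_3) : AR_deg g (nth 0%N [:: 1; 3; 3] i) (w i).
Proof.
have hT1 : T1 \is homog 2 by rewrite /T1; homogeneous.
have hT : T \is homog 2 by rewrite /T; homogeneous.
split.
  apply/ARE; rewrite /g dirDM dirD_std_conic dirD_pencil /pencil_mpoly !mpolyC0.
  move: i; apply: ord3P; rewrite /w /two_tacnodes_gen /= !mxE /= /T /T1 /std_conic; ring.
move: i; apply: ord3P; apply: ord3P; rewrite /w /= mxE /=; homogeneous.
Qed.

Lemma eval_T1 (x y z : K) : eval T1 (row3 x y z) = 2 * l * (x * z - y ^+ 2) + b * y ^+ 2.
Proof.
rewrite /T1 mevalD !mevalM eval_std_conic rmorph_nat !mevalC !mevalXU !mxE /=.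
ring.
Qed.

Lemma eval_T (x y z : K) : eval T (row3 x y z) =
  2 * l * (x * z - y ^+ 2) + b * y ^+ 2 - b * (x * z - y ^+ 2).
Proof. by rewrite /T mevalB eval_T1 mevalM mevalC eval_std_conic. Qed.

Lemma T1_neq0 : T1 != 0.
Proof.
apply/eqP => /(congr1 (fun p => eval p (row3 1 0 1 : 'rV[K]_3))).
rewrite eval_T1 meval0 => /eqP; apply/negP.
by rewrite (_ : _ + _ = 2 * l) ?mulf_neq0 ?pnatr_eq0 //; ring.
Qed.

Lemma two_tacnodes_span : AR g = submodule_span w [set: 'I_3]%SET.
Proof.
apply/seteqP; split=> [v|]; last first.
  by apply: span_sub_AR => i; case: (two_tacnodes_gen_deg i).
case/(AR_split hf2) => _ [h [E1 E2]].
rewrite dirD_std_conic in E1; rewrite dirD_pencil E1 /pencil_mpoly !mpolyC0 in E2.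
have EY : Y * (2 * B * v 0 o1) = T1 * (- h).
  apply/eqP; rewrite -subr_eq0; apply/eqP; move/eqP: E2; rewrite -subr_eq0 => /eqP E2.
  by rewrite -[RHS]E2 /T1; ring.
have [k hk] : exists k, - h = Y * k.
  apply: (dvd_var (u := row3 1 0 1) _ _ EY); first by rewrite mxE.
  by rewrite eval_T1 (_ : _ + _ = 2 * l) ?mulf_neq0 ?pnatr_eq0 //; ring.
have v1E : 2 * B * v 0 o1 = T1 * k.
  by apply: (mulfI (mpolyX_neq0 K o1)); rewrite EY hk; ring.
have hE : h = - (Y * k) by rewrite -hk opprK.
have E3 : B * (v 0 o0 * Z + v 0 o2 * X) = Y * T * k.
  transitivity (B * (Q * h) + Y * (2 * B * v 0 o1)); first by rewrite -E1; ring.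
  by rewrite v1E hE /T; ring.
(* By [E3] the product y T k lies in the ideal (x, z). Neither y nor T does, the value of T at (0,
   1, 0) being 2 (b - l), so k = x k1 + z k3. *)
have [k1 kE] := kill_decomp o0 k.
have [k3 k3E] : exists r, kill o0 k = Z * r.
  apply: (dvd_var (i := o2) (p := B * kill o0 (v 0 o0)) (q := Y * kill o0 T) (u := row3 0 1 0)).
  - by rewrite mxE.
  - rewrite mevalM mevalXU eval_kill ?mxE //= eval_T.
    rewrite [X in X != 0](_ : _ = 2 * (b - l)); last by rewrite /=; ring.
    by rewrite mulf_neq0 ?pnatr_eq0 // subr_eq0 eq_sym.
  have := congr1 (kill o0) E3; rewrite !rmorphM /= rmorphD !rmorphM /= !killX killC /=.
  by rewrite mulr0 addr0 => <-; ring.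
rewrite k3E in kE.
have [r [r0 r2]] : exists r, B * v 0 o0 - Y * T * k3 = X * r /\ Y * T * k1 - B * v 0 o2 = Z * r.
  apply: (@proportional_var _ o2 o0) => //.
  apply/eqP; rewrite -subr_eq0; apply/eqP; move/eqP: E3; rewrite -subr_eq0 => /eqP E3.
  by rewrite -[RHS]E3 kE; ring.
have [Bi HB] : exists Bi, 2 * B * Bi = 1.
  exists (mpolyC 3 (2 * b)^-1); rewrite -mpolyC_nat -!mpolyCM divff ?mpolyC1 //.
  by rewrite mulf_neq0 ?pnatr_eq0.
have cancelB x y : 2 * B * x = y -> x = Bi * y.
  by move=> <-; transitivity (2 * B * Bi * x); [rewrite HB mul1r|ring].
apply: (span3 (a0 := 2 * Bi * r) (a1 := - Bi * k1) (a2 := - Bi * k3)).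
apply: row3_eq; rewrite /w /two_tacnodes_gen /= !mxE /=; apply: etrans (cancelB _ _ (erefl _)) _.
- by rewrite -mulrA -[B * _](subrK (Y * T * k3)) r0; ring.
- by rewrite v1E kE; ring.
- rewrite -mulrA (_ : B * _ = Y * T * k1 - (Y * T * k1 - B * v 0 o2)); last by ring.
  by rewrite r2; ring.
Qed.

Lemma two_tacnodes_generator_degrees : AR_generator_degrees g [:: 1; 3; 3]%N.
Proof.
split=> //; exists w; split; first exact: two_tacnodes_gen_deg.
  exact: two_tacnodes_span.
apply: irredundant => [i|]; first by case: (two_tacnodes_gen_deg i).
(* A redundant generator would make one variable a multiple of another. *)
have contra (i j : 'I_3) : i != j -> forall a : polyS K, mpolyX K (mnm1 i) = a * mpolyX K (mnm1 j) -> False.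
  move=> iDj a /(congr1 (fun p => eval p (delta_mx 0 i : 'rV[K]_3))).
  rewrite mevalM !mevalXU !mxE !eqxx eq_sym (negPf iDj) andbF mulr0 => /eqP.
  by rewrite oner_eq0.
apply: ord3P => a a0; rewrite sum3 a0 => /rowP E.
- have := E o0; rewrite /w /two_tacnodes_gen /= !mxE /= => e.
  apply: (contra o0 o1 isT (- (2 * a o2 * T))); rewrite [LHS]e; ring.
- have := E o1; rewrite /w /two_tacnodes_gen /= !mxE /= => e.
  apply: (contra o0 o2 isT (a o2)); apply: (mulfI T1_neq0).
  by transitivity (- (- (X * T1))); [ring|rewrite e; ring].
- have := E o1; rewrite /w /two_tacnodes_gen /= !mxE /= => e.
  apply: (contra o2 o0 isT (a o1)); apply: (mulfI T1_neq0).
  by transitivity (- (- (Z * T1))); [ring|rewrite e; ring].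
Qed.

End TwoTacnodes.
End Generators.

(** * Generators for a node and an A_5 *)

Section OsculatingGenerators.
Variable K : numFieldType.
Variables l c : K.
Hypotheses (l0 : l != 0) (c0 : c != 0).
Local Notation Q := (std_conic K).
Local Notation L := (mpolyC 3 l).
Local Notation C := (mpolyC 3 c).

(** With v Q = h Q, these fields have h = 2 c y, 2 c z and 0. The third kills both conics and is
    proportional to the cross product of their gradients. *)
Definition osculating_gen : seq 'rV[polyS K]_3 :=
  [:: row3 (5 * C * X * Y + 6 * L * X ^+ 2) (C * Y ^+ 2 + 2 * L * X * Y)
        (4 * L * Y ^+ 2 - 3 * C * Y * Z - 6 * L * X * Z);
      row3 (5 * C * X * Z - 12 * L * X * Y) (C * Y * Z - 4 * L * X * Z)
        (4 * L * Y * Z - 3 * C * Z ^+ 2);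
      row3 (X * Z + 2 * Y ^+ 2) (Y * Z) (- Z ^+ 2)].

Let w (i : 'I_3) := nth 0 osculating_gen i.
Let g : polyS K := Q * pencil_mpoly l 0 0 c 0.

Let hf2 : veronese (pencil_mpoly l 0 0 c 0) != 0.
Proof. by apply/eqP => /veronese_pencil_eq0 [_ _ ce]; have := c0; rewrite ce eqxx. Qed.

Lemma osculating_gen_deg (i : 'I_3) : AR_deg g (nth 0%N [:: 2; 2; 2] i) (w i).
Proof.
split.
  apply/ARE; rewrite /g dirDM dirD_std_conic dirD_pencil /pencil_mpoly !mpolyC0.
  move: i; apply: ord3P; rewrite /w /osculating_gen /= !mxE /= /std_conic; ring.
move: i; apply: ord3P; apply: ord3P; rewrite /w /= mxE /=; homogeneous.
Qed.

Lemma osculating_span : AR g = submodule_span w [set: 'I_3]%SET.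
Proof.
apply/seteqP; split=> [v|]; last first.
  by apply: span_sub_AR => i; case: (osculating_gen_deg i).
case/(AR_split hf2) => _ [h [E1 E2]].
rewrite dirD_std_conic in E1; rewrite dirD_pencil E1 /pencil_mpoly !mpolyC0 in E2.
(* With Q expanded, each equation is regrouped as z times one factor equals y times another; the
   common quotients [p], [q] and [r] become the new unknowns. *)
have [p [p1 p2]] : exists p, C * v 0 o1 + h * (2 * L * X + C * Y) = Y * p /\
    2 * L * h * Y - C * v 0 o2 = Z * p.
  apply: (@proportional_var _ o2 o1) => //.
  apply/eqP; rewrite -subr_eq0; apply/eqP; move/eqP: E2; rewrite -subr_eq0 => /eqP E2.
  by rewrite -[RHS]E2 /std_conic; ring.
have c1E : C * v 0 o1 = Y * p - h * (2 * L * X + C * Y) by rewrite -p1; ring.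
have c2E : C * v 0 o2 = 2 * L * h * Y - Z * p by rewrite -p2; ring.
have [q [q0 q1]] : exists q, C * v 0 o0 - X * (C * h + p) = Y * q /\
    Y * (2 * p - 3 * C * h) - 6 * L * X * h = Z * q.
  apply: (@proportional_var _ o2 o1) => //.
  have E3 : C * v 0 o0 * Z = C * (Q * h) - X * (C * v 0 o2) + 2 * Y * (C * v 0 o1).
    by rewrite -E1; ring.
  transitivity (C * v 0 o0 * Z - X * Z * (C * h + p)); first by ring.
  by rewrite E3 c1E c2E /std_conic; ring.
(* Modulo z the equation [q1] reads y (2 p - 3 c h) = 6 l x h, so y divides h there, and h = y h1 +
   z h2. *)
have [h2 hE] := kill_decomp o2 h.
have [h1 h1E] : exists r, kill o2 h = Y * r.
  apply: (dvd_var (i := o1) (p := kill o2 (2 * p - 3 * C * h)) (q := 6 * L * X) (u := row3 1 0 0)).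
  - by rewrite mxE.
  - by rewrite !mevalM rmorph_nat mevalC mevalXU mxE /= mulr1 mulf_neq0 ?pnatr_eq0.
  have := congr1 (kill o2) q1; rewrite rmorphB !rmorphM /= !killX killC /= rmorph_nat.
  by rewrite mul0r => /eqP; rewrite subr_eq0 => /eqP.
rewrite h1E in hE.
have [r [r0 r1]] : exists r, 2 * p - 3 * C * h - 6 * L * X * h1 = Z * r /\
    q + 6 * L * X * h2 = Y * r.
  apply: (@proportional_var _ o1 o2) => //.
  transitivity (Y * (2 * p - 3 * C * h) - 6 * L * X * (Y * h1)); first by ring.
  rewrite (_ : Y * h1 = h - Z * h2); last by rewrite hE; ring.
  by rewrite [RHS]mulrDr -q1; ring.
have [Ci HC] : exists Ci, 2 * C * Ci = 1.
  exists (mpolyC 3 (2 * c)^-1); rewrite -mpolyC_nat -!mpolyCM divff ?mpolyC1 //.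
  by rewrite mulf_neq0 ?pnatr_eq0.
have cancelC x y : 2 * C * x = y -> x = Ci * y.
  by move=> <-; transitivity (2 * C * Ci * x); [rewrite HC mul1r|ring].
have pE : 2 * p = Z * r + 3 * C * h + 6 * L * X * h1 by rewrite -r0; ring.
have qE : q = Y * r - 6 * L * X * h2 by rewrite -r1; ring.
have d0E : 2 * C * v 0 o0 = 2 * X * C * h + X * (2 * p) + 2 * Y * q.
  by rewrite -mulrA -[C * v 0 o0](subrK (X * (C * h + p))) q0; ring.
apply: (span3 (a0 := Ci * h1) (a1 := Ci * h2) (a2 := Ci * r)).
apply: row3_eq; rewrite /w /osculating_gen /= !mxE /=; apply: etrans (cancelC _ _ (erefl _)) _.
- by rewrite d0E pE qE hE; ring.
- transitivity (Ci * (Y * (2 * p) - 2 * h * (2 * L * X + C * Y))).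
    by rewrite -mulrA c1E; ring.
  by rewrite pE hE; ring.
- transitivity (Ci * (4 * L * h * Y - Z * (2 * p))).
    by rewrite -mulrA c2E; ring.
  by rewrite pE hE; ring.
Qed.

Let column (j : 'I_3) (a : 'I_3 -> polyS K) i : w i = a o0 *: w o0 + a o1 *: w o1 + a o2 *: w o2 ->
  w i 0 j = a o0 * w o0 0 j + a o1 * w o1 0 j + a o2 * w o2 0 j.
Proof. by move=> {1}->; rewrite !mxE. Qed.

Let w00 : w o0 0 o0 = 5 * C * X * Y + 6 * L * X ^+ 2. Proof. by rewrite mxE. Qed.
Let w10 : w o1 0 o0 = 5 * C * X * Z - 12 * L * X * Y. Proof. by rewrite mxE. Qed.
Let w20 : w o2 0 o0 = X * Z + 2 * Y ^+ 2. Proof. by rewrite mxE. Qed.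
Let w02 : w o0 0 o2 = 4 * L * Y ^+ 2 - 3 * C * Y * Z - 6 * L * X * Z. Proof. by rewrite mxE. Qed.
Let w12 : w o1 0 o2 = 4 * L * Y * Z - 3 * C * Z ^+ 2. Proof. by rewrite mxE. Qed.
Let w22 : w o2 0 o2 = - Z ^+ 2. Proof. by rewrite mxE. Qed.

Lemma osculating_generator_degrees : AR_generator_degrees g [:: 2; 2; 2]%N.
Proof.
split=> //; exists w; split; first exact: osculating_gen_deg.
  exact: osculating_span.
apply: irredundant => [i|]; first by case: (osculating_gen_deg i).
have Lneq0 : (4 * L : polyS K) != 0.
  by rewrite -mpolyC_nat -mpolyCM mpolyC_eq0 mulf_neq0 ?pnatr_eq0.
have Yneq0 := mpolyX_neq0 K o1.
have Hk k : 4 * L * Y ^+ 2 * k = 0 -> k = 0.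
  by move/eqP; rewrite mulf_eq0 mulf_eq0 (negPf Lneq0) expf_eq0 (negPf Yneq0) => /eqP.
have cancel2Y (p q : polyS K) : 2 * Y * p = 2 * Y * q -> p = q.
  apply: mulfI; rewrite mulf_neq0 // -mpolyC_nat mpolyC_eq0 pnatr_eq0 //.
apply: ord3P => a a0; rewrite sum3 => /column E.
- have := congr1 (fun p => eval p (row3 1 0 0 : 'rV[K]_3)) (E o0).
  rewrite /= a0 w00 w10 w20 !(rmorph_nat, mevalD, mevalN, mevalM) !mevalC !mevalXU ?meval0.
  rewrite !mxE /= => /eqP; apply/negP; rewrite -subr_eq0.
  rewrite [X in X != 0](_ : _ = 6 * l); last by ring.
  by rewrite mulf_neq0 ?pnatr_eq0.
(* Modulo z only the first generator has a nonzero third entry, so its coefficient vanishes; the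
   first entries then make x a multiple of y. *)
- have e0 := congr1 (kill o2) (E o0); have e2 := congr1 (kill o2) (E o2).
  move: e0 e2; rewrite a0 w00 w10 w20 w02 w12 w22.
  rewrite !(rmorph_nat, rmorphD, rmorphN, rmorphM) /= !killX !killC ?raddf0 /=.
  set k0 := kill o2 (a o0); set k2 := kill o2 (a o2) => e0 e2.
  have k00 : k0 = 0.
    by apply: Hk; transitivity (0 : polyS K); last by []; apply: etrans (etrans (esym e2) _); ring.
  have : - (6 * L * X) = Y * k2.
    by apply: cancel2Y; apply: etrans (etrans _ e0) _; rewrite ?k00; ring.
  move/(congr1 (fun p => eval p (row3 1 0 0 : 'rV[K]_3))).
  rewrite !(mevalN, mevalM) mevalC !mevalXU rmorph_nat !mxE /= mul0r mulr1 => /eqP.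
  by rewrite oppr_eq0; apply/negP; rewrite mulf_neq0 ?pnatr_eq0.
- have e0 := congr1 (kill o2) (E o0); have e2 := congr1 (kill o2) (E o2).
  move: e0 e2; rewrite a0 w00 w10 w20 w02 w12 w22.
  rewrite !(rmorph_nat, rmorphD, rmorphN, rmorphM) /= !killX !killC ?raddf0 /=.
  set k0 := kill o2 (a o0); set k1 := kill o2 (a o1) => e0 e2.
  have k00 : k0 = 0.
    by apply: Hk; transitivity (0 : polyS K); last by []; apply: etrans (etrans (esym e2) _); ring.
  have : Y = - (6 * L * X * k1).
    by apply: cancel2Y; apply: etrans (etrans _ e0) _; rewrite ?k00; ring.
  move/(congr1 (fun p => eval p (row3 0 1 0 : 'rV[K]_3))).
  rewrite !(mevalN, mevalM) mevalC !mevalXU rmorph_nat !mxE /= mulr0 mul0r oppr0 => /eqP.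
  by rewrite oner_eq0.
Qed.

End OsculatingGenerators.

(** * A basis for an A_7 *)

Section HyperosculatingGenerators.
Variable K : numFieldType.
Variables l d : K.
Hypotheses (l0 : l != 0) (d0 : d != 0).
Local Notation Q := (std_conic K).
Local Notation L := (mpolyC 3 l).
Local Notation D := (mpolyC 3 d).

Let T : polyS K := 2 * L * Q + D * Z ^+ 2.

(** The first field generates a unipotent group fixing z and the first conic. The second has v Q = 2
    d z Q. The degrees 1 and 2 add up to 3, as freeness of a quartic requires. *)
Definition hyperosculating_gen : seq 'rV[polyS K]_3 :=
  [:: row3 (2 * Y) Z 0;
      row3 (2 * L * X ^+ 2 + 3 * D * X * Z) (L * X * Y + D * Y * Z) (- T)].

Let w (i : 'I_2) := nth 0 hyperosculating_gen i.
Let g : polyS K := Q * pencil_mpoly l 0 0 0 d.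

Let hf2 : veronese (pencil_mpoly l 0 0 0 d) != 0.
Proof. by apply/eqP => /veronese_pencil_eq0 [_ _ _ de]; have := d0; rewrite de eqxx. Qed.

Lemma hyperosculating_gen_deg (i : 'I_2) : AR_deg g (nth 0%N [:: 1; 2] i) (w i).
Proof.
have hT : T \is homog 2 by rewrite /T; homogeneous.
split.
  apply/ARE; rewrite /g dirDM dirD_std_conic dirD_pencil /pencil_mpoly !mpolyC0.
  case: i => [[|[|i]] lti] //; rewrite /w /hyperosculating_gen /= !mxE /= /T /std_conic; ring.
case: i => [[|[|i]] lti] //; apply: ord3P; rewrite /w /= mxE /=; homogeneous.
Qed.

Let eval_T (x y z : K) : eval T (row3 x y z) = 2 * l * (x * z - y ^+ 2) + d * z ^+ 2.
Proof.
rewrite /T mevalD !mevalM eval_std_conic rmorph_nat !mevalC !mevalXU !mxE /=.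
ring.
Qed.

Let eval_T_neq0 : eval T (row3 0 1 0) != 0.
Proof.
rewrite eval_T (_ : _ + _ = - (2 * l)); last by ring.
by rewrite oppr_eq0 mulf_neq0 ?pnatr_eq0.
Qed.

Lemma hyperosculating_span : AR g = submodule_span w [set: 'I_2]%SET.
Proof.
apply/seteqP; split=> [v|]; last first.
  by apply: span_sub_AR => i; case: (hyperosculating_gen_deg i).
case/(AR_split hf2) => _ [h [E1 E2]].
rewrite dirD_std_conic in E1; rewrite dirD_pencil E1 /pencil_mpoly !mpolyC0 in E2.
have EZ : Z * (2 * D * v 0 o2) = T * (- h).
  apply/eqP; rewrite -subr_eq0; apply/eqP; move/eqP: E2; rewrite -subr_eq0 => /eqP E2.
  by rewrite -[RHS]E2 /T; ring.
have [k hk] : exists k, - h = Z * k.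
  by apply: (dvd_var (u := row3 0 1 0) _ _ EZ); rewrite ?mxE.
have v2E : 2 * D * v 0 o2 = T * k.
  by apply: (mulfI (mpolyX_neq0 K o2)); rewrite EZ hk; ring.
have hE : h = - (Z * k) by rewrite -hk opprK.
have [r [r0 r1]] : exists r,
    2 * D * v 0 o0 + k * (2 * L * X ^+ 2 + 3 * D * X * Z) = Y * r /\
    2 * (2 * D * v 0 o1 + k * (L * X * Y + D * Y * Z)) = Z * r.
  apply: (@proportional_var _ o2 o1) => //.
  have E3 : 2 * D * v 0 o0 * Z = 2 * D * (Q * h) - X * (2 * D * v 0 o2) + 2 * Y * (2 * D * v 0 o1).
    by rewrite -E1; ring.
  transitivity (2 * D * v 0 o0 * Z + Z * k * (2 * L * X ^+ 2 + 3 * D * X * Z)); first by ring.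
  by rewrite E3 v2E hE /T /std_conic; ring.
have [Di HD] : exists Di, 4 * D * Di = 1.
  exists (mpolyC 3 (4 * d)^-1); rewrite -mpolyC_nat -!mpolyCM divff ?mpolyC1 //.
  by rewrite mulf_neq0 ?pnatr_eq0.
have cancelD x y : 4 * D * x = y -> x = Di * y.
  by move=> <-; transitivity (4 * D * Di * x); [rewrite HD mul1r|ring].
exists (fun i => nth 0 [:: Di * r; - (2 * Di * k)] i).
rewrite (eq_bigl predT) => [|i]; last by rewrite finset.in_setT.
rewrite !big_ord_recl big_ord0 addr0.
apply: row3_eq; rewrite /w /hyperosculating_gen /= !mxE /=;
  apply: etrans (cancelD _ _ (erefl _)) _.
- transitivity (2 * Di * (Y * r - k * (2 * L * X ^+ 2 + 3 * D * X * Z))); last by ring.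
  by rewrite -r0; ring.
- transitivity (Di * (Z * r - 2 * k * (L * X * Y + D * Y * Z))); last by ring.
  by rewrite -r1; ring.
- transitivity (2 * Di * (2 * D * v 0 o2)); first by ring.
  by rewrite v2E; ring.
Qed.

Lemma hyperosculating_free : free_curve g.
Proof.
exists 2%N, (fun i => nth 0%N [:: 1; 2] i), w; split.
- exact: hyperosculating_gen_deg.
- exact: hyperosculating_span.
have T0 : T != 0 by apply: contraNneq eval_T_neq0 => ->; rewrite meval0.
(* The basis is triangular: the third entry of the first field is 0, which isolates [a i1]. *)
move=> a; rewrite !big_ord_recl big_ord0 addr0.
set i0 : 'I_2 := ord0; set i1 : 'I_2 := lift _ _ => /rowP E.
have a1 : a i1 = 0.
  have := E o2; rewrite /w /hyperosculating_gen /= !mxE /= => e.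
  apply: (mulIf T0); rewrite mul0r -[RHS]oppr0 -e; ring.
have a0 : a i0 = 0.
  have := E o0; rewrite /w /hyperosculating_gen /= !mxE /= a1 => e.
  have Y2 : 2 * Y != 0 :> polyS K.
    by rewrite mulf_neq0 ?mpolyX_neq0 // -mpolyC_nat mpolyC_eq0 pnatr_eq0.
  apply: (mulIf Y2); rewrite mul0r; apply: etrans e; ring.
move=> [[|[|i]] lti] //.
  by rewrite -a0; congr (a _); apply: val_inj.
by rewrite -a1; congr (a _); apply: val_inj.
Qed.

End HyperosculatingGenerators.

Lemma AR_deg2_pencil_neq0 (K : numFieldType) (l a b c : K) : c != 0 ->
  AR_deg (std_conic K * pencil_mpoly l a b c 0) 2 != [set 0].
Proof.
move=> c0; pose A := mpolyC 3 a; pose B := mpolyC 3 b; pose C := mpolyC 3 c.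
pose G : polyS K := A * X + 2 * B * Y + C * Z.
have hG : G \is homog 1 by rewrite /G; homogeneous.
(* the cross product of the gradients of the two conics *)
pose v := row3 (- (2 * C * Y ^+ 2) - X * G) (A * X * Y - C * Y * Z) (Z * G + 2 * A * Y ^+ 2).
apply: (AR_deg_neq0 (v := v)).
  split; last by apply: ord3P; rewrite mxE /=; homogeneous.
  apply/ARE; rewrite dirDM dirD_std_conic dirD_pencil /pencil_mpoly !mpolyC0.
  by rewrite !mxE /= /G /std_conic -/A -/B -/C; ring.
apply/eqP => /rowP/(_ o1); rewrite !mxE /=.
move/(congr1 (fun p => eval p (row3 0 1 1 : 'rV[K]_3))).
rewrite meval0 mevalB !mevalM !mevalC !mevalXU !mxE /= mulr0 mul0r sub0r !mulr1 => /eqP.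
by rewrite oppr_eq0 (negPf c0).
Qed.

(** * Normal forms *)

Section QuadraticForms.
Variable K : numClosedFieldType.
Implicit Types (A M : 'M[K]_3) (p : polyS K) (u v w : 'rV[K]_3).

Definition varX : 'rV[polyS K]_3 := \row_i mpolyX K (mnm1 i).

Definition quad A : polyS K := (varX *m map_mx (@mpolyC 3 K) A *m varX^T) 0 0.

Definition bil A u v : K := (u *m A *m v^T) 0 0.

Lemma quadE A : quad A = \sum_i \sum_j A i j *: (mpolyX K (mnm1 i) * mpolyX K (mnm1 j)).
Proof.
rewrite /quad mxE exchange_big /=; apply: eq_bigr => j _.
rewrite !mxE mulr_suml; apply: eq_bigr => i _.
by rewrite !mxE -mul_mpolyC; ring.
Qed.

Lemma quadD A B : quad (A + B) = quad A + quad B.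
Proof. by rewrite /quad map_mxD mulmxDr mulmxDl mxE. Qed.

Lemma quadZ c A : quad (c *: A) = c *: quad A.
Proof.
rewrite !quadE scaler_sumr; apply: eq_bigr => i _; rewrite scaler_sumr.
by apply: eq_bigr => j _; rewrite mxE scalerA.
Qed.

Lemma quad_tr A : quad A^T = quad A.
Proof.
rewrite !quadE exchange_big; apply: eq_bigr => i _; apply: eq_bigr => j _.
by rewrite mxE mulrC.
Qed.

Lemma homog2_quad p : p \is homog 2 -> exists A, A^T = A /\ p = quad A.
Proof.
move/dhomogP => hp.
suff [A ->] : exists A, p = quad A.
  exists (2^-1 *: (A + A^T)); split; first by rewrite linearZ /= linearD /= trmxK addrC.
  rewrite quadZ quadD quad_tr (_ : quad A + quad A = 2 *: quad A); last first.
    by rewrite scaler_nat mulr2n.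
  rewrite scalerA.
  by rewrite mulVf ?pnatr_eq0 // scale1r.
rewrite (mpolyE p) big_seq; elim/big_ind: _ => [|p1 p2 [A ->] [B ->]|m /hp m2].
- by exists 0; have := quadZ 0 0; rewrite !scale0r => ->.
- by exists (A + B); rewrite quadD.
have [i mi] : exists i, m i != 0%N.
  apply/existsP; apply: contraT; rewrite negb_exists => /forallP m0.
  suff mE : m = mnm0 by move: m2; rewrite mE /= mdeg0.
  by apply/mnmP => i; rewrite mnm0E; apply/eqP/negPn/m0.
have le_im : lem (mnm1 i) m by rewrite lep1mP.
have := mdegD (mnm_sub m (mnm1 i)) (mnm1 i); rewrite submK // mdeg1 m2 addn1 => -[/esym/eqP].
rewrite mdeg_eq1 => /existsP [j /eqP mE].
exists (mcoeff m p *: delta_mx j i); rewrite quadZ; congr (_ *: _).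
rewrite -[in LHS](submK le_im) mE mpolyXD quadE (bigD1 j) //= (bigD1 i) //= mxE !eqxx scale1r.
rewrite !big1 ?addr0 // => k kDi; last by rewrite mxE (negPf kDi) andbF scale0r.
by rewrite big1 // => l _; rewrite mxE (negPf kDi) scale0r.
Qed.

Lemma eval_quad A v : eval (quad A) v = bil A v v.
Proof.
transitivity (\sum_i \sum_j A i j * (v 0 i * v 0 j)).
  rewrite quadE raddf_sum; apply: eq_bigr => i _; rewrite raddf_sum /=.
  by apply: eq_bigr => j _; rewrite mevalZ mevalM !mevalXU.
rewrite exchange_big /bil [RHS]mxE; apply: eq_bigr => j _ /=.
by rewrite [in RHS]mxE mulr_suml; apply: eq_bigr => i _; rewrite !mxE; ring.
Qed.

Lemma subst_quad M A : subst M (quad A) = quad (M *m A *m M^T).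
Proof.
have substX_ : map_mx (subst M) varX = varX *m map_mx (@mpolyC 3 K) M.
  apply/rowP => i; rewrite !mxE substX; apply: eq_bigr => k _.
  by rewrite !mxE -mul_mpolyC mulrC.
have substA : map_mx (subst M) (map_mx (@mpolyC 3 K) A) = map_mx (@mpolyC 3 K) A.
  by apply/matrixP => i j; rewrite !mxE substC.
transitivity ((map_mx (subst M) (varX *m map_mx (@mpolyC 3 K) A *m varX^T)) 0 0).
  by rewrite mxE.
rewrite !map_mxM -map_trmx substX_ substA /quad !map_mxM trmx_mul map_trmx.
by rewrite !mulmxA.
Qed.

Lemma bilC A u v : A^T = A -> bil A u v = bil A v u.
Proof.
move=> sA; rewrite /bil -[in LHS]sA -[in RHS](trmxK (v *m A *m u^T)) [RHS]mxE.
by rewrite !trmx_mul trmxK sA mulmxA.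
Qed.

Lemma bilDl A u v w : bil A (u + v) w = bil A u w + bil A v w.
Proof. by rewrite /bil !mulmxDl mxE. Qed.

Lemma bilZl A c u w : bil A (c *: u) w = c * bil A u w.
Proof. by rewrite /bil -!scalemxAl mxE. Qed.

Lemma bilDr A u v w : bil A w (u + v) = bil A w u + bil A w v.
Proof. by rewrite /bil linearD mulmxDr mxE. Qed.

Lemma bilZr A c u w : bil A w (c *: u) = c * bil A w u.
Proof. by rewrite /bil linearZ /= -scalemxAr mxE. Qed.

Definition rows3 u v w : 'M[K]_3 := \matrix_i nth 0 [:: u; v; w] i.

Lemma row_rows3 u v w i : row i (rows3 u v w) = nth 0 [:: u; v; w] i.
Proof. by rewrite rowK. Qed.

Lemma mul_rows3 u v w (x y z : K) : row3 x y z *m rows3 u v w = x *: u + y *: v + z *: w.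
Proof.
rewrite mulmx_sum_row sum3 !row_rows3 /=.
by rewrite !mxE.
Qed.

Lemma gramE A M i j : (M *m A *m M^T) i j = bil A (row i M) (row j M).
Proof.
rewrite /bil tr_row mxE [RHS]mxE; apply: eq_bigr => k _.
by rewrite -row_mul !mxE.
Qed.

Lemma eval_mderiv_quad A v i : A^T = A -> eval (mderiv i (quad A)) v = 2 * (v *m A) 0 i.
Proof.
move=> sA; rewrite quadE (raddf_sum (mderiv i)) /= raddf_sum.
transitivity (\sum_j \sum_k A j k * ((i == j)%:R * v 0 k + v 0 j * (i == k)%:R)).
  apply: eq_bigr => j _; rewrite /= (raddf_sum (mderiv i)) /= raddf_sum; apply: eq_bigr => k _ /=.
  rewrite mderivZ mevalZ mderivM !mderivXU mevalD !mevalM !mevalXU.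
  by rewrite !rmorph_nat.
have S1 : \sum_j \sum_k A j k * ((i == j)%:R * v 0 k) = (v *m A) 0 i.
  rewrite (bigD1 i) //= [X in _ + X]big1 ?addr0 => [|j jDi].
    by rewrite mxE; apply: eq_bigr => k _; rewrite eqxx mul1r mulrC -[in LHS]sA mxE.
  by rewrite big1 // => k _; rewrite eq_sym (negPf jDi) mul0r mulr0.
have S2 : \sum_j \sum_k A j k * (v 0 j * (i == k)%:R) = (v *m A) 0 i.
  rewrite mxE; apply: eq_bigr => j _; rewrite (bigD1 i) //= eqxx mulr1 big1 ?addr0 => [|k kDi].
    by rewrite mulrC.
  by rewrite eq_sym (negPf kDi) !mulr0.
rewrite mulr_natl mulr2n -[in X in X + _]S1 -S2 -big_split; apply: eq_bigr => j _ /=.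
by rewrite -big_split; apply: eq_bigr => k _ /=; rewrite mulrDr.
Qed.

(** A nonzero row vector killed by [A] would be a point of the conic where the gradient 2 v A
    vanishes as well. *)
Lemma smooth_quad_unit A : A^T = A -> smooth (quad A) -> A \in unitmx.
Proof.
move=> sA smA; rewrite -row_free_unit -kermx_eq0; apply: contraT => kA0.
pose v := nz_row (kermx A).
have vA : v *m A = 0 by apply/sub_kermxP/nz_row_sub.
have v0 : v != 0 by rewrite nz_row_eq0.
have e0 : eval (quad A) v = 0 by rewrite eval_quad /bil vA mul0mx mxE.
have [j] := smA v v0 e0.
by rewrite eval_mderiv_quad // vA mxE mulr0 eqxx.
Qed.

Lemma quad3 A : A^T = A -> quad A = pC (A o0 o0) * X ^+ 2 + pC (A o1 o1) * Y ^+ 2 +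
  pC (A o2 o2) * Z ^+ 2 + pC (2 * A o0 o1) * (X * Y) + pC (2 * A o1 o2) * (Y * Z) +
  pC (2 * A o0 o2) * (X * Z).
Proof.
move=> sA; have sE i j : A i j = A j i by rewrite -[in LHS]sA mxE.
rewrite quadE !sum3 -!mul_mpolyC !mpolyCM mpolyC_nat.
by rewrite (sE o1 o0) (sE o2 o0) (sE o2 o1); ring.
Qed.

Lemma exists_root n (c : 'I_n.+2 -> K) : c ord_max != 0 ->
  exists x, \sum_(i < n.+2) c i * x ^+ i = 0.
Proof.
move=> cn; pose P k := - (c (inord k) / c ord_max).
have [x xE] := @solve_monicpoly K n.+1 P isT; exists x.
rewrite big_ord_recr /= xE mulr_sumr -big_split big1 // => i _ /=.
rewrite /P (_ : inord i = widen_ord (leqnSn n.+1) i); last first.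
  by apply: val_inj; rewrite /= inordK // ltnW // ltnS.
by rewrite mulrA mulrN mulrCA divff // mulr1 mulNr subrr.
Qed.

Lemma quadratic_root (a b c : K) : a != 0 -> exists x, a * x ^+ 2 + b * x + c = 0.
Proof.
move=> a0; have [x xE] := @exists_root 1 (fun i => nth 0 [:: c; b; a] i) a0.
by exists x; rewrite -[RHS]xE !big_ord_recr big_ord0 /=; ring.
Qed.

Lemma cubic_root (a b c d : K) : a != 0 -> exists x, a * x ^+ 3 + b * x ^+ 2 + c * x + d = 0.
Proof.
move=> a0; have [x xE] := @exists_root 2 (fun i => nth 0 [:: d; c; b; a] i) a0.
by exists x; rewrite -[RHS]xE !big_ord_recr big_ord0 /=; ring.
Qed.

Lemma quartic_root (a b c d e : K) : a != 0 ->
  exists x, a * x ^+ 4 + b * x ^+ 3 + c * x ^+ 2 + d * x + e = 0.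
Proof.
move=> a0; have [x xE] := @exists_root 3 (fun i => nth 0 [:: e; d; c; b; a] i) a0.
by exists x; rewrite -[RHS]xE !big_ord_recr big_ord0 /=; ring.
Qed.

Lemma row3_neq0 (x y z : K) : (x != 0) || (y != 0) || (z != 0) -> row3 x y z != 0.
Proof.
apply: contraTneq => /rowP E; have := E o0; have := E o1; have := E o2.
by rewrite !mxE /= => -> -> ->; rewrite eqxx.
Qed.

Lemma quad_isotropic A : A^T = A -> exists2 v, v != 0 & bil A v v = 0.
Proof.
move=> sA; pose e0 : 'rV[K]_3 := row3 1 0 0; pose e1 : 'rV[K]_3 := row3 0 1 0.
have [A00|A00] := eqVneq (bil A e0 e0) 0.
  by exists e0 => //; apply: row3_neq0; rewrite oner_eq0.
have [s sE] := quadratic_root (2 * bil A e0 e1) (bil A e1 e1) A00.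
exists (s *: e0 + e1).
  apply/eqP => /rowP/(_ o1); rewrite !mxE /= mulr0 add0r => /eqP.
  by rewrite oner_eq0.
rewrite !(bilDl, bilDr, bilZl, bilZr) (bilC e1 e0 sA) -[RHS]sE; ring.
Qed.

(** The Gram matrix of x z - y^2. *)
Definition std_mx : 'M[K]_3 :=
  rows3 (row3 0 0 2^-1) (row3 0 (-1) 0) (row3 2^-1 0 0).

Lemma std_mx_unit : std_mx \in unitmx.
Proof.
apply: (proj1 (mulmx1_unit (B := rows3 (row3 0 0 2) (row3 0 (-1) 0) (row3 2 0 0)) _)).
apply/row_matrixP => i; rewrite row_mul row_rows3; move: i; apply: ord3P => /=;
  rewrite mul_rows3 rowE; apply: row3_eq; rewrite !mxE sum3 !mxE /=; by field.
Qed.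

End QuadraticForms.

(** * Frames adapted to two points of the first conic *)

Section NormalForm.
Variable K : numClosedFieldType.
Implicit Types (A M : 'M[K]_3) (f : polyS K) (r u v w : 'rV[K]_3).

Definition normal_form f1 f2 M l a b c d : Prop :=
  [/\ M \in unitmx, subst M f1 = std_conic K & subst M f2 = pencil_mpoly l a b c d].

Lemma unit_bil_neq0 A u : A \in unitmx -> u != 0 -> exists w, bil A u w != 0.
Proof.
move=> uA u0; have : u *m A != 0.
  by apply: contra_neq u0 => e; rewrite -(mulmxK uA u) e mul0mx.
case/rV0Pn => i ui; exists (delta_mx 0 i).
by rewrite /bil trmx_delta -colE mxE.
Qed.

(** A line through [r] that is not tangent there meets the conic in a second point, found by moving
    along [r]. *)
Lemma isotropic_partner A r : A^T = A -> A \in unitmx -> r != 0 -> bil A r r = 0 ->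
  exists2 w, bil A w w = 0 & bil A r w != 0.
Proof.
move=> sA uA r0 rr; have [w rw] := unit_bil_neq0 uA r0.
exists (w + (- bil A w w / (2 * bil A r w)) *: r).
  rewrite !(bilDl, bilDr, bilZl, bilZr) rr (bilC w r sA); by field.
by rewrite bilDr bilZr rr mulr0 addr0.
Qed.

Lemma orthogonal_pair A u v : exists2 r, r != 0 & bil A r u = 0 /\ bil A r v = 0.
Proof.
pose N := row_mx (A *m u^T) (A *m v^T).
have : kermx N != 0.
  rewrite kermx_eq0 /row_free; apply/eqP => e.
  by have := rank_leq_col N; rewrite e.
rewrite -nz_row_eq0 => r0; exists (nz_row (kermx N)) => //.
have /sub_kermxP : (nz_row (kermx N) <= kermx N)%MS by exact: nz_row_sub.
rewrite mul_mx_row -(row_mx0 K 1 1 1) => /eq_row_mx [e1 e2].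
by rewrite /bil -!mulmxA e1 e2 mxE.
Qed.

(* r0, r1 and a multiple of r2 form a basis in which A is x z - y^2. *)
Lemma isotropic_frame A r0 r2 : A^T = A -> A \in unitmx ->
  bil A r0 r0 = 0 -> bil A r2 r2 = 0 -> bil A r0 r2 != 0 ->
  exists r1 k, [/\ k != 0, bil A r0 r1 = 0, bil A r1 (k *: r2) = 0,
    bil A r1 r1 = -1 & 2 * bil A r0 (k *: r2) = 1].
Proof.
move=> sA uA b00 b22 b02.
have [u u0 [bu0 bu2]] := orthogonal_pair A r0 r2.
(* [u] is the pole of the chord through r0 and r2. Were it isotropic, it would be orthogonal to the
   basis r0, u, r2, against nondegeneracy. *)
have bu : bil A u u != 0.
  apply/eqP => buu.
  have uM : rows3 r0 u r2 \in unitmx.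
    rewrite -row_free_unit -kermx_eq0 -nz_row_eq0; apply: contraT => w0.
    set w := nz_row _ in w0.
    have /sub_kermxP : (w <= kermx (rows3 r0 u r2))%MS by exact: nz_row_sub.
    rewrite (row3E w) mul_rows3 => e.
    have e2 := congr1 (bil A r2) e; have e0 := congr1 (bil A r0) e.
    have b0 r : bil A r 0 = 0 by rewrite /bil trmx0 mulmx0 mxE.
    rewrite !(bilDr, bilZr) b0 (bilC r2 u sA) bu2 b22 !mulr0 !addr0 (bilC _ _ sA) in e2.
    rewrite !(bilDr, bilZr) b0 (bilC r0 u sA) bu0 b00 !mulr0 !add0r in e0.
    move/eqP: e2; rewrite mulf_eq0 (negPf b02) orbF => /eqP w00.
    move/eqP: e0; rewrite mulf_eq0 (negPf b02) orbF => /eqP w02.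
    move: e; rewrite w00 w02 !scale0r add0r addr0 => /eqP.
    rewrite scaler_eq0 (negPf u0) orbF => /eqP w01.
    have w0' : w = 0 by apply: row3_eq; rewrite ?w00 ?w01 ?w02 mxE.
    by rewrite w0' eqxx in w0.
  have : u *m A *m (rows3 r0 u r2)^T = 0.
    apply/rowP => i; rewrite [RHS]mxE.
    have -> : (u *m A *m (rows3 r0 u r2)^T) 0 i = bil A u (row i (rows3 r0 u r2)).
      by rewrite /bil tr_row mxE [RHS]mxE; apply: eq_bigr => k _; rewrite [col _ _ _ _]mxE.
    by rewrite row_rows3; move: i; apply: ord3P; rewrite /= ?bu0 ?buu ?bu2.
  have uMT : (rows3 r0 u r2)^T \in unitmx by rewrite unitmx_tr.
  move/(congr1 (mulmx^~ (invmx (rows3 r0 u r2)^T))); rewrite mul0mx mulmxK //.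
  move/(congr1 (mulmx^~ (invmx A))); rewrite mul0mx mulmxK // => e.
  by rewrite e eqxx in u0.
pose s := sqrtC (- (bil A u u)^-1).
have s2 : s ^+ 2 = - (bil A u u)^-1 by rewrite sqrtCK.
exists (s *: u), (2 * bil A r0 r2)^-1.
rewrite !(bilZl, bilZr) (bilC r0 u sA) bu0 bu2 !mulr0; split=> //.
- by rewrite invr_eq0 mulf_neq0 ?pnatr_eq0.
- by rewrite mulrA -expr2 s2 mulNr mulVf.
- by field.
Qed.

Lemma quad_normal_form A1 A2 r0 r1 r2 : A1^T = A1 -> A2^T = A2 ->
  bil A1 r0 r0 = 0 -> bil A1 r2 r2 = 0 -> bil A1 r0 r1 = 0 -> bil A1 r1 r2 = 0 ->
  bil A1 r1 r1 = -1 -> 2 * bil A1 r0 r2 = 1 -> bil A2 r0 r0 = 0 ->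
  exists l a b c, normal_form (quad A1) (quad A2) (rows3 r0 r1 r2) l a b c (bil A2 r2 r2).
Proof.
move=> sA1 sA2 b00 b22 b01 b12 b11 b02 c00.
pose M := rows3 r0 r1 r2.
have g A (i j : 'I_3) : (M *m A *m M^T) i j = bil A (nth 0 [:: r0; r1; r2] i) (nth 0 [:: r0; r1; r2] j).
  by rewrite gramE !row_rows3.
have sM A : A^T = A -> (M *m A *m M^T)^T = M *m A *m M^T.
  by move=> sA; rewrite !trmx_mul trmxK sA mulmxA.
(* The multiple [l] of x z - y^2 contributes - l to the coefficient of y^2, which the third witness
   compensates. *)
exists (2 * bil A2 r0 r2), (2 * bil A2 r0 r1), (bil A2 r1 r1 + 2 * bil A2 r0 r2), (2 * bil A2 r1 r2).
split.
- have stdE : M *m A1 *m M^T = std_mx K.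
    have n2 : 2 != 0 :> K by rewrite pnatr_eq0.
    have b02' : bil A1 r0 r2 = 2^-1 by apply: (mulfI n2); rewrite b02 divff.
    apply/matrixP => i j; rewrite g /std_mx mxE; move: i j; apply: ord3P; apply: ord3P;
    by rewrite /= mxE //= ?(bilC r1 r0) ?(bilC r2 r0) ?(bilC r2 r1).
  by have := std_mx_unit K; rewrite -stdE -mulmxA unitmx_mul => /andP[].
- rewrite subst_quad quad3 ?sM // !g /= b00 b11 b22 b01 b12 b02 !mulr0 !mpolyC0 mpolyCN !mpolyC1.
  by rewrite /std_conic; ring.
- rewrite subst_quad quad3 ?sM // !g /= c00 mpolyC0 /pencil_mpoly /std_conic.
  by rewrite !mpolyCD; ring.
Qed.

End NormalForm.

(** * Intersection points and tangency *)

Section Geometry.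
Variable K : numClosedFieldType.
Implicit Types (M : 'M[K]_3) (f : polyS K) (u v w : 'rV[K]_3).

Definition grad f v : 'rV[K]_3 := \row_i eval (mderiv i f) v.

(** Gradients in K^3 transform by the transpose of the frame ([grad_subst]), so this notion does not
    depend on coordinates and needs no chart. *)
Definition tangent f1 f2 v : Prop := exists m, grad f2 v = m *: grad f1 v.

Lemma grad_subst M f w : grad (subst M f) w = grad f (w *m M) *m M^T.
Proof.
apply/rowP => k; rewrite !mxE mderiv_subst raddf_sum; apply: eq_bigr => i _ /=.
by rewrite mevalZ eval_subst !mxE mulrC.
Qed.

Lemma mderiv_dirD i f : mderiv i f = dirD (delta_mx 0 i) f.
Proof.
rewrite /dirD (bigD1 i) //= mxE !eqxx mul1r big1 ?addr0 // => j jDi.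
by rewrite mxE (negPf jDi) andbF mul0r.
Qed.

Lemma grad_std_conic (x y z : K) : grad (std_conic K) (row3 x y z) = row3 z (- 2 * y) x.
Proof.
apply/rowP; apply: ord3P; rewrite mxE mderiv_dirD dirD_std_conic !mxE /=;
  by rewrite !(mevalD, mevalN, mevalM, mevalXU, meval0, meval1) !mxE /=; ring.
Qed.

Lemma grad_pencil l a b c d (x y z : K) : grad (pencil_mpoly l a b c d) (row3 x y z) =
  row3 (l * z + a * y) (a * x + 2 * b * y + c * z - 2 * l * y) (l * x + c * y + 2 * d * z).
Proof.
apply/rowP; apply: ord3P; rewrite mxE mderiv_dirD dirD_pencil !mxE /=;
  by rewrite !(mevalD, mevalN, mevalM, mevalXU, meval0, meval1, mevalC) !mxE /=; ring.
Qed.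

Lemma smooth_grad f v : smooth f -> v != 0 -> eval f v = 0 -> grad f v != 0.
Proof.
move=> smf v0 fv; have [k fk] := smf v v0 fv.
by apply: contraNneq fk => /rowP/(_ k); rewrite !mxE => ->.
Qed.

Section Conics.
Variables f1 f2 : polyS K.
Hypotheses (conic1 : smooth_conic f1) (conic2 : smooth_conic f2).
Hypothesis distinct : curve f1 <> curve f2.

Let cap := curve f1 `&` curve f2.

Section Frame.
Variables (M : 'M[K]_3) (l a b c d : K).
Hypothesis nf : normal_form f1 f2 M l a b c d.

Let uM : M \in unitmx. Proof. by case: nf. Qed.

Lemma nf_eval1 x y z : eval f1 (row3 x y z *m M) = x * z - y ^+ 2.
Proof. by case: nf => _ E _; rewrite -eval_subst E eval_std_conic. Qed.

Lemma nf_eval2 x y z : eval f2 (row3 x y z *m M) = pencil l a b c d x y z.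
Proof. by case: nf => _ _ E; rewrite -eval_subst E eval_pencil. Qed.

Lemma nf_coord v : exists x y z, v = row3 x y z *m M.
Proof.
exists ((v *m invmx M) 0 o0), ((v *m invmx M) 0 o1), ((v *m invmx M) 0 o2).
by rewrite -row3E mulmxKV.
Qed.

Lemma nf_neq0 x y z : row3 x y z != 0 -> row3 x y z *m M != 0.
Proof. by apply: contra_neq => e; rewrite -(mulmxK uM (row3 x y z)) e mul0mx. Qed.

Lemma nf_tangent x y z : tangent f1 f2 (row3 x y z *m M) <->
  exists m, [/\ l * z + a * y = m * z, a * x + 2 * b * y + c * z - 2 * l * y = - 2 * m * y &
                l * x + c * y + 2 * d * z = m * x].
Proof.
have uMT : M^T \in unitmx by rewrite unitmx_tr.
have [_ E1 E2] := nf.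
have g1 := grad_subst M f1 (row3 x y z); rewrite E1 grad_std_conic in g1.
have g2 := grad_subst M f2 (row3 x y z); rewrite E2 grad_pencil in g2.
split=> -[m E]; exists m.
  move: g2; rewrite E -scalemxAl -g1 => /rowP e.
  have := e o0; have := e o1; have := e o2; rewrite !mxE /= => e2 e1 e0.
  by split=> //; rewrite e1; ring.
case: E => e0 e1 e2; rewrite -[LHS](mulmxK uMT) -g2 -[RHS](mulmxK uMT) -scalemxAl -g1.
congr (_ *m _); apply: row3_eq; rewrite !mxE /= ?e0 ?e1 ?e2 //; ring.
Qed.

Lemma nf_grad2_neq0 x y z : row3 x y z != 0 -> pencil l a b c d x y z = 0 ->
  row3 (l * z + a * y) (a * x + 2 * b * y + c * z - 2 * l * y) (l * x + c * y + 2 * d * z) != 0.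
Proof.
move=> w0 f2w; have [_ smf2] := conic2.
have g0 : grad f2 (row3 x y z *m M) != 0.
  by apply: smooth_grad => //; [apply: nf_neq0 | rewrite nf_eval2].
have [_ _ E2] := nf; rewrite -grad_pencil -E2 grad_subst.
have uMT : M^T \in unitmx by rewrite unitmx_tr.
by apply: contra_neq g0 => e; rewrite -[LHS](mulmxK uMT) e mul0mx.
Qed.

(** At (1:0:0) the gradient of the second conic is (0, a, l). *)
Lemma nf_l_neq0 : a = 0 -> l != 0.
Proof.
move=> a0; have w0 : row3 (1 : K) 0 0 != 0 by apply: row3_neq0; rewrite oner_eq0.
have e0 : pencil l a b c d 1 0 0 = 0 by rewrite /pencil; ring.
apply: contraNneq (nf_grad2_neq0 w0 e0) => le.
by apply/eqP; apply: row3_eq; rewrite !mxE /= ?le ?a0; ring.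
Qed.

(** For [l = b] the second conic would be l x z, singular at (0:1:0). *)
Lemma nf_l_neq_b : a = 0 -> c = 0 -> d = 0 -> l != b.
Proof.
move=> a0 c0 d0; have w0 : row3 (0 : K) 1 0 != 0 by apply: row3_neq0; rewrite oner_eq0 orbT.
apply/eqP => le; have e0 : pencil l a b c d 0 1 0 = 0 by rewrite /pencil le; ring.
case/negP: (nf_grad2_neq0 w0 e0).
by apply/eqP; apply: row3_eq; rewrite !mxE /= le ?a0 ?c0; ring.
Qed.

(** Otherwise the second conic is [l] times the first with [l] nonzero, and the curves coincide. *)
Lemma nf_coef_neq0 : ~ [/\ a = 0, b = 0, c = 0 & d = 0].
Proof.
move=> [a0 b0 c0 d0]; have l0 := nf_l_neq0 a0; apply: distinct.
have E v : eval f2 v = l * eval f1 v.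
  have [x [y [z ->]]] := nf_coord v; rewrite nf_eval2 nf_eval1 /pencil a0 b0 c0 d0; ring.
apply/seteqP; split=> p [Pp fp]; split=> // v /fp; first by rewrite E => ->; rewrite mulr0.
by rewrite E => /eqP; rewrite mulf_eq0 (negPf l0) => /eqP.
Qed.

End Frame.
End Conics.
End Geometry.

Lemma card_uniq_seq (T : choiceType) (s : seq T) : uniq s -> [set` s] #= `I_(size s).
Proof.
elim: s => [_|x s IH /= /andP[xs us]].
  by rewrite (_ : [set` [::]] = set0) ?II0 ?card_eq00 //; apply/seteqP; split.
apply/eq_cardSP; exists x; first by rewrite /= inE eqxx.
rewrite (_ : _ `\ x = [set` s]); first exact: IH.
apply/seteqP; split=> y /=.
  by case=> + /eqP yx; rewrite inE (negPf yx).
move=> ys; split; first by rewrite inE ys orbT.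
by move=> yx; rewrite -yx ys in xs.
Qed.

Section ProjectivePoints.
Variable K : numClosedFieldType.
Implicit Types (u v w : 'rV[K]_3) (p : {vspace 'rV[K]_3}).

Lemma P2P p : P2 p -> exists2 v, v != 0 & p = <[v]>%VS.
Proof.
rewrite /P2 /= => dp; exists (vpick p).
  by rewrite vpick0 -dimv_eq0 dp.
apply/esym/eqP; rewrite eqEdim -memvE memv_pick dp dim_vline.
by rewrite vpick0 -dimv_eq0 dp.
Qed.

Lemma P2_vline v : v != 0 -> P2 <[v]>%VS.
Proof. by move=> v0; rewrite /P2 /= dim_vline v0. Qed.

Lemma vline_scale k v : k != 0 -> (<[k *: v]> = <[v]>)%VS.
Proof.
move=> k0; apply/eqP; rewrite eqEsubv -!memvE memvZ ?memv_line //=.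
by rewrite -[X in X \in _](scalerK k0) memvZ ?memv_line.
Qed.

Lemma vline_eq u v : (<[u]> = <[v]>)%VS -> exists k, u = k *: v.
Proof.
by move=> e; apply/vlineP; rewrite -e memv_line.
Qed.

Lemma curve_vline (f : polyS K) v : f \is homog 2 -> v != 0 ->
  curve f <[v]>%VS <-> eval f v = 0.
Proof.
move=> /homog2_quad [A [_ ->]] v0; split=> [[_]|fv]; first by apply; rewrite memv_line.
split=> [|w /vlineP [k ->]]; first exact: P2_vline.
by rewrite eval_quad bilZl bilZr -eval_quad fv !mulr0.
Qed.

End ProjectivePoints.

(** * Common points of the two conics *)

Section ConicPair.
Variable K : numClosedFieldType.
Implicit Types (M : 'M[K]_3) (f : polyS K) (u v w : 'rV[K]_3).
Variables f1 f2 : polyS K.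
Hypotheses (conic1 : smooth_conic f1) (conic2 : smooth_conic f2).

Let cap := curve f1 `&` curve f2.

Lemma cap_vline v : v != 0 -> cap <[v]>%VS <-> eval f1 v = 0 /\ eval f2 v = 0.
Proof.
move=> v0; case: conic1 => h1 _; case: conic2 => h2 _.
by rewrite -(curve_vline h1 v0) -(curve_vline h2 v0).
Qed.

Lemma nf_at v : v != 0 -> eval f1 v = 0 -> eval f2 v = 0 ->
  exists M l a b c d, normal_form f1 f2 M l a b c d /\ v = e100 K *m M.
Proof.
case: conic1 => /homog2_quad [A1 [sA1 ->]] sm1; case: conic2 => /homog2_quad [A2 [sA2 ->]] _.
have uA1 : A1 \in unitmx by apply: smooth_quad_unit.
rewrite !eval_quad => v0 fv1 fv2.
have [w ww vw] := isotropic_partner sA1 uA1 v0 fv1.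
have [r [k [k0 vr rw rr vkw]]] := isotropic_frame sA1 uA1 fv1 ww vw.
have ww' : bil A1 (k *: w) (k *: w) = 0 by rewrite bilZl bilZr ww !mulr0.
have [l [a [b [c nf]]]] := quad_normal_form sA1 sA2 fv1 ww' vr rw rr vkw fv2.
exists (rows3 v r (k *: w)), l, a, b, c, (bil A2 (k *: w) (k *: w)); split=> //.
by rewrite /e100 mul_rows3 scale1r !scale0r !addr0.
Qed.

Lemma nf_two v w : v != 0 -> w != 0 -> eval f1 v = 0 -> eval f2 v = 0 ->
  eval f1 w = 0 -> eval f2 w = 0 -> (<[v]> != <[w]>)%VS ->
  exists M l a b c k, [/\ k != 0, normal_form f1 f2 M l a b c 0, v = e100 K *m M &
    k *: w = row3 0 0 1 *m M].
Proof.
move=> v0 w0 fv1 fv2 fw1 fw2 vDw.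
(* The tangent at [v] meets the conic at [v] only, so two distinct points of the conic are never
   orthogonal. *)
have vw : forall A1 : 'M[K]_3, A1^T = A1 -> f1 = quad A1 -> bil A1 v w != 0.
  move=> A1 sA1 f1E; have uA1 : A1 \in unitmx.
    by apply: smooth_quad_unit => //; rewrite -f1E; case: conic1.
  rewrite f1E !eval_quad in fv1 fw1.
  have [u uu vu] := isotropic_partner sA1 uA1 v0 fv1.
  have [r [k [k0 vr ru rr vku]]] := isotropic_frame sA1 uA1 fv1 uu vu.
  have uu' : bil A1 (k *: u) (k *: u) = 0 by rewrite bilZl bilZr uu !mulr0.
  (* Only the coordinates of [w] in this frame are wanted, so the first form is paired with
     itself. *)
  have [l [a [b [c nf]]]] := quad_normal_form sA1 sA1 fv1 uu' vr ru rr vku fv1.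
  have [x [y [z wE]]] := nf_coord nf w; rewrite mul_rows3 in wE.
  have vku0 : bil A1 v (k *: u) != 0.
    by rewrite bilZr mulf_neq0.
  apply: contra_neq vDw => vw.
  have z0 : z = 0.
    move: vw; rewrite wE !bilDr !bilZr fv1 vr !mulr0 !add0r => /eqP.
    by rewrite -bilZr mulf_eq0 (negPf vku0) orbF => /eqP.
  have y0 : y = 0.
    move: fw1; rewrite wE z0 scale0r addr0 !(bilDl, bilDr, bilZl, bilZr) fv1 rr (bilC r v sA1) vr.
    move=> e; have : y ^+ 2 = 0 by rewrite -[RHS]oppr0 -[in RHS]e; ring.
    by move/eqP; rewrite expf_eq0 => /eqP.
  move: wE; rewrite z0 y0 !scale0r !addr0 => wE.
  rewrite wE vline_scale //; apply: contra_neq w0 => x0.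
  by rewrite wE x0 scale0r.
case: conic1 vw => /homog2_quad [A1 [sA1 f1E]] sm1 /(_ A1 sA1 f1E) vw.
case: conic2 => /homog2_quad [A2 [sA2 f2E]] _.
have uA1 : A1 \in unitmx by apply: smooth_quad_unit; rewrite -?f1E.
rewrite f1E !eval_quad in fv1 fw1; rewrite f2E !eval_quad in fv2 fw2.
have [r [k [k0 vr rw rr vkw]]] := isotropic_frame sA1 uA1 fv1 fw1 vw.
have ww' : bil A1 (k *: w) (k *: w) = 0 by rewrite bilZl bilZr fw1 !mulr0.
have [l [a [b [c nf]]]] := quad_normal_form sA1 sA2 fv1 ww' vr rw rr vkw fv2.
have d0 : bil A2 (k *: w) (k *: w) = 0 by rewrite bilZl bilZr fw2 !mulr0.
rewrite d0 -f1E -f2E in nf.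
exists (rows3 v r (k *: w)), l, a, b, c, k; split=> //.
  by rewrite /e100 mul_rows3 scale1r !scale0r !addr0.
by rewrite mul_rows3 scale1r !scale0r !add0r.
Qed.

(** On the conic parametrised by s^2 v + s r + w', the second form is a polynomial of degree 4 in s
    with leading coefficient its value at [v]. Either [v] is a common point, or a root gives one. *)
Lemma common_point : exists v, [/\ v != 0, eval f1 v = 0 & eval f2 v = 0].
Proof.
case: conic1 => /homog2_quad [A1 [sA1 ->]] sm1; case: conic2 => /homog2_quad [A2 [sA2 ->]] _.
have uA1 : A1 \in unitmx by apply: smooth_quad_unit.
have [v v0 fv1] := quad_isotropic sA1.
have [fv2|fv2] := eqVneq (bil A2 v v) 0; first by exists v; rewrite !eval_quad.
have [w ww vw] := isotropic_partner sA1 uA1 v0 fv1.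
have [r [k [k0 vr rw rr vkw]]] := isotropic_frame sA1 uA1 fv1 ww vw.
have ww' : bil A1 (k *: w) (k *: w) = 0 by rewrite bilZl bilZr ww !mulr0.
move: (k *: w) rw vkw ww' => w' rw vkw ww'.
have [s sE] := quartic_root (2 * bil A2 v r) (bil A2 r r + 2 * bil A2 v w')
  (2 * bil A2 r w') (bil A2 w' w') fv2.
exists (s ^+ 2 *: v + s *: r + w').
split.
- apply: contra_neq (oner_neq0 K) => e.
  have := congr1 (fun u => 2 * bil A1 v u) e.
  rewrite /= !(bilDr, bilZr) fv1 vr !mulr0 !add0r vkw => ->.
  by rewrite /bil trmx0 mulmx0 mxE mulr0.
- rewrite eval_quad !(bilDl, bilDr, bilZl, bilZr) fv1 ww' rr (bilC r v sA1) vr (bilC w' r sA1) rw.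
  rewrite (bilC w' v sA1); transitivity (s ^+ 2 * (2 * bil A1 v w') - s ^+ 2); first by ring.
  by rewrite vkw; ring.
- rewrite eval_quad !(bilDl, bilDr, bilZl, bilZr) (bilC r v sA2) (bilC w' r sA2) (bilC w' v sA2).
  by rewrite -[RHS]sE; ring.
Qed.

Section Frame.
Variables (M : 'M[K]_3) (l a b c d : K).
Hypothesis nf : normal_form f1 f2 M l a b c d.

(** The parametrised conic without the base point of the frame, which is the parameter at
    infinity. *)
Definition conic_point M (t : K) : {vspace 'rV[K]_3} := <[row3 (t ^+ 2) t 1 *m M]>%VS.

Let uM : M \in unitmx. Proof. by case: nf. Qed.

Lemma conic_point_neq0 t : row3 (t ^+ 2) t 1 *m M != 0.
Proof. by apply: (nf_neq0 nf); apply: row3_neq0; rewrite oner_eq0 !orbT. Qed.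

Lemma conic_point_inj : injective (conic_point M).
Proof.
move=> s t /vline_eq [k]; rewrite scalemxAl => /(congr1 (mulmx^~ (invmx M))).
rewrite !mulmxK // => /rowP E; have := E o1; have := E o2.
by rewrite !mxE /= mulr1 => <-; rewrite mul1r.
Qed.

Lemma conic_point_neq t : conic_point M t != <[e100 K *m M]>%VS.
Proof.
apply/eqP => /vline_eq [k]; rewrite scalemxAl => /(congr1 (mulmx^~ (invmx M))).
rewrite !mulmxK // => /rowP/(_ o2); rewrite !mxE /= mulr0 => /eqP.
by rewrite oner_eq0.
Qed.

Lemma cap_conic_point t :
  cap (conic_point M t) <-> a * t ^+ 3 + b * t ^+ 2 + c * t + d = 0.
Proof.
rewrite /conic_point (cap_vline (conic_point_neq0 t)) (nf_eval1 nf) (nf_eval2 nf) /pencil.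
split=> [[_ <-]|E]; first by ring.
by split; [ring|rewrite -E; ring].
Qed.

Lemma capE p : cap p <-> p = <[e100 K *m M]>%VS \/
  exists2 t, a * t ^+ 3 + b * t ^+ 2 + c * t + d = 0 & p = conic_point M t.
Proof.
split=> [cp|[->|[t tE ->]]]; last exact/cap_conic_point.
  have [[Pp _] _] := cp; have [v v0 pE] := P2P Pp.
  have [x [y [z vE]]] := nf_coord nf v.
  move: cp; rewrite pE (cap_vline v0) vE (nf_eval1 nf) (nf_eval2 nf) => -[E1 E2].
  have [z0|z0] := eqVneq z 0.
    have y0 : y = 0.
      by move: E1; rewrite z0 mulr0 sub0r => /eqP; rewrite oppr_eq0 expf_eq0 => /eqP.
    left; rewrite (_ : row3 x y z = x *: e100 K); last first.
      by rewrite y0 z0; apply: row3_eq; rewrite !mxE /= ?mulr1 ?mulr0.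
    rewrite -scalemxAl vline_scale //; apply: contra_neq v0 => x0.
    rewrite vE (_ : row3 x y z = 0) ?mul0mx //.
    by rewrite x0 y0 z0; apply: row3_eq; rewrite !mxE.
  have E : row3 x y z = z *: row3 ((y / z) ^+ 2) (y / z) 1.
    apply: row3_eq; rewrite !mxE /= ?mulr1 //; last by field.
    by apply: (mulIf z0); rewrite -[LHS](subrK (y ^+ 2)) E1; field.
  have pE' : p = conic_point M (y / z) by rewrite pE vE E -scalemxAl vline_scale.
  right; exists (y / z); last by rewrite -vE -pE.
  apply/cap_conic_point; rewrite -pE' pE; apply/cap_vline => //.
  by rewrite vE (nf_eval1 nf) (nf_eval2 nf).
have e0 : e100 K *m M != 0.
  by apply: (nf_neq0 nf); apply: row3_neq0; rewrite oner_eq0.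
apply: (proj2 (cap_vline e0)).
by rewrite /e100 (nf_eval1 nf) (nf_eval2 nf) /pencil; split; ring.
Qed.

(** The base point is the root at infinity of the restricted quartic, whence the successor. *)
Lemma cap_seq (s : seq K) :
  (forall t, a * t ^+ 3 + b * t ^+ 2 + c * t + d = 0 <-> t \in s) -> uniq s ->
  cap = [set` <[e100 K *m M]>%VS :: map (conic_point M) s] /\ cap #= `I_(size s).+1.
Proof.
move=> sE us; have capE' : cap = [set` <[e100 K *m M]>%VS :: map (conic_point M) s].
  apply/seteqP; split=> p /=.
    move=> /capE [->|[t /sE ts ->]]; first by rewrite inE eqxx.
    by rewrite inE map_f ?orbT.
  rewrite inE => /orP[/eqP ->|/mapP [t ts ->]]; apply/capE; first by left.
  by right; exists t => //; apply/sE.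
split=> //; rewrite capE' -(size_map (conic_point M)); apply: (@card_uniq_seq _ (_ :: _)).
rewrite /= map_inj_uniq ?us ?andbT; last exact: conic_point_inj.
by apply/negP => /mapP [t _ e]; have := conic_point_neq t; rewrite e eqxx.
Qed.

End Frame.
End ConicPair.

(** * Singularities and invariants read off a frame *)

Section Classification.
Variable K : numClosedFieldType.
Implicit Types (M : 'M[K]_3) (u v w : 'rV[K]_3).
Variables f1 f2 : polyS K.
Hypotheses (conic1 : smooth_conic f1) (conic2 : smooth_conic f2).
Hypothesis distinct : curve f1 <> curve f2.

Let cap := curve f1 `&` curve f2.
Let f := f1 * f2.

Section Frame.
Variables (M : 'M[K]_3) (l a b c d : K).
Hypothesis nf : normal_form f1 f2 M l a b c d.

Let uM : M \in unitmx. Proof. by case: nf. Qed.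

Lemma nf_product : subst M f = std_conic K * pencil_mpoly l a b c d.
Proof. by have [_ E1 E2] := nf; rewrite rmorphM /= E1 E2. Qed.

Lemma nf_veronese_neq0 : veronese (pencil_mpoly l a b c d) != 0.
Proof. by apply/eqP => /veronese_pencil_eq0; apply: (nf_coef_neq0 conic2 distinct nf). Qed.

Lemma nf_mdr1 : AR_deg (std_conic K * pencil_mpoly l a b c d) 1 != [set 0] -> mdr f = 1%N.
Proof.
move=> h; rewrite -(mdr_subst f uM) nf_product; apply: mdrE => // -[|] // _.
exact: (AR_deg0_pencil nf_veronese_neq0).
Qed.

Lemma nf_mdr2 : AR_deg (std_conic K * pencil_mpoly l a b c d) 1 = [set 0] ->
  AR_deg (std_conic K * pencil_mpoly l a b c d) 2 != [set 0] -> mdr f = 2%N.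
Proof.
move=> h1 h2; rewrite -(mdr_subst f uM) nf_product; apply: mdrE => // -[|[|]] // _.
exact: (AR_deg0_pencil nf_veronese_neq0).
Qed.

Lemma nf_eval_product x y z : eval f (row3 x y z *m M) =
  (x * z - y ^+ 2) * pencil l a b c d x y z.
Proof. by rewrite /f mevalM (nf_eval1 nf) (nf_eval2 nf). Qed.

Lemma nf_measure : (mmeasure mdeg f).-1 = 4.
Proof.
have [h1 _] := conic1; have [h2 _] := conic2; have hf := dhomogM h1 h2.
have f0 : f != 0.
  have : std_conic K * pencil_mpoly l a b c d != 0.
    rewrite mulf_neq0 ?std_conic_neq0 //.
    by apply: contraNneq nf_veronese_neq0 => ->; rewrite raddf0.
  by rewrite -nf_product; apply: contraNneq => ->; rewrite raddf0.
exact: (dhomog_uniq f0 (dhomog_msize hf) hf).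
Qed.

Lemma nf_nearly_free d1 d2 : (d1 + d2 = 4)%N ->
  AR_generator_degrees (std_conic K * pencil_mpoly l a b c d) [:: d1; d2; d2] ->
  nearly_free f d1 d2.
Proof.
move=> dE h; split; last by rewrite nf_measure.
by apply: (AR_generator_degrees_subst uM); rewrite nf_product.
Qed.

Lemma nf_node : a != 0 -> singularity_A 1 f <[e100 K *m M]>%VS.
Proof. exact: (node_singularity uM nf_eval_product). Qed.

Lemma nf_tangency n m e0 e1 e2 : a = 0 -> e0 != 0 ->
  (forall y, b * y ^+ 2 + c * y ^+ 3 + d * y ^+ 4 =
    y ^+ m.+2 * (e0 + e1 * y + e2 * y ^+ 2)) ->
  n.+1 = (m.+2 * 2)%N -> singularity_A n f <[e100 K *m M]>%VS.
Proof.
move=> a0; exact: (tangency_singularity uM nf_eval_product a0 (nf_l_neq0 conic2 nf a0)).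
Qed.

Lemma nf_tangent_base : tangent f1 f2 (e100 K *m M) <-> a = 0.
Proof.
rewrite /e100 (nf_tangent nf); split=> [[m [_ + _]]|a0]; first by rewrite !mulr0 !addr0 mulr1 subr0.
by exists l; rewrite a0; split; ring.
Qed.

Lemma nf_tangent_opposite : tangent f1 f2 (row3 0 0 1 *m M) <-> c = 0 /\ d = 0.
Proof.
rewrite (nf_tangent nf); split=> [[m [_ e1 e2]]|[c0 d0]].
  split; first by rewrite -[LHS](addr0) -[X in _ + X](subrr (2 * l * 0)) -[RHS](mulr0 (- 2 * m)) -e1; ring.
  by apply: (@natf_mul_eq0 _ 1); rewrite -[RHS](mulr0 m) -e2; ring.
by exists l; rewrite c0 d0; split; ring.
Qed.

End Frame.

(** Any common point can be the base point of a frame, where not being tangent means [a != 0]. *)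
Lemma transverse_node v : v != 0 -> eval f1 v = 0 -> eval f2 v = 0 ->
  ~ tangent f1 f2 v -> singularity_A 1 f <[v]>%VS.
Proof.
move=> v0 fv1 fv2 nt; have [M [l [a [b [c [d [nf vE]]]]]]] := nf_at conic1 conic2 v0 fv1 fv2.
rewrite vE; apply: (nf_node nf); apply/eqP => a0; apply: nt.
by rewrite vE; apply/(nf_tangent_base nf).
Qed.

End Classification.

(** * Classification *)

Section MainCases.
Variable K : numClosedFieldType.
Implicit Types (M : 'M[K]_3) (u v w : 'rV[K]_3).
Variables f1 f2 : polyS K.
Hypotheses (conic1 : smooth_conic f1) (conic2 : smooth_conic f2).
Hypothesis distinct : curve f1 <> curve f2.

Let cap := curve f1 `&` curve f2.
Let f := f1 * f2.

Lemma hyperosculating_case M l b c d : b = 0 -> c = 0 -> normal_form f1 f2 M l 0 b c d ->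
  [/\ cap #= `I_1, forall p, cap p -> singularity_A 7 f p, mdr f = 1%N & free_curve f].
Proof.
move=> b0 c0 nf; rewrite b0 c0 in nf; have l0 := nf_l_neq0 conic2 nf erefl.
have d0 : d != 0 by apply/eqP => d0; case: (nf_coef_neq0 conic2 distinct nf).
have [capE card] : cap = [set` [:: <[e100 K *m M]>%VS]] /\ cap #= `I_1.
  apply: (cap_seq conic1 conic2 nf (s := [::])) => // t.
  rewrite (_ : _ + _ = d) ?in_nil; last by ring.
  by split=> // de; rewrite de eqxx in d0.
have [uM _ _] := nf.
split=> //.
- move=> p; rewrite capE /= inE => /eqP ->.
  (* Contact order [m.+2 = 4] gives A_7; the other cases have order 3 for A_5 and 2 for A_3. *)
  by apply: (nf_tangency conic2 nf (m := 2) (e0 := d) (e1 := 0) (e2 := 0)) => // y; ring.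
- apply: (nf_mdr1 conic2 distinct nf).
  apply: (AR_deg_neq0 (hyperosculating_gen_deg l d ord0)).
  apply/eqP => /rowP/(_ o1); rewrite !mxE /= => /eqP; apply/negP.
  exact: mpolyX_neq0.
- apply: (free_curve_subst uM); rewrite (nf_product nf).
  exact: hyperosculating_free.
Qed.

Lemma osculating_case M l c : c != 0 -> normal_form f1 f2 M l 0 0 c 0 ->
  cap #= `I_2 /\
  [/\ exists2 p, cap p & singularity_A 1 f p /\
        forall q, cap q -> q <> p -> singularity_A 5 f q,
      mdr f = 2%N & nearly_free f 2 2].
Proof.
move=> c0 nf; have l0 := nf_l_neq0 conic2 nf erefl.
have [capE card] : cap = [set` [:: <[e100 K *m M]>%VS; conic_point M 0]] /\ cap #= `I_2.
  apply: (cap_seq conic1 conic2 nf (s := [:: 0])) => // t.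
  rewrite (_ : _ + _ = c * t); last by ring.
  by rewrite inE; split=> [/eqP|/eqP ->]; rewrite ?mulr0 // mulf_eq0 (negPf c0).
split=> //; split.
- exists (conic_point M 0); first by rewrite capE /= !inE eqxx orbT.
  split.
    have /(cap_vline conic1 conic2 (conic_point_neq0 nf 0)) [E1 E2] : cap (conic_point M 0).
      by rewrite capE /= !inE eqxx orbT.
    apply: (transverse_node conic1 conic2) => //; first exact: conic_point_neq0 nf 0.
    rewrite expr0n /= => /(nf_tangent_opposite nf) [c_eq0 _].
    by rewrite c_eq0 eqxx in c0.
  move=> q; rewrite capE /= !inE => /orP[/eqP ->|/eqP ->] // _.
  by apply: (nf_tangency conic2 nf (m := 1) (e0 := c) (e1 := 0) (e2 := 0)) => // y; ring.
- apply: (nf_mdr2 conic2 distinct nf); first exact: AR_deg1_tangent.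
  exact: AR_deg2_pencil_neq0.
- apply: (nf_nearly_free conic1 conic2 distinct nf) => //.
  exact: osculating_generator_degrees.
Qed.

Lemma two_tacnodes_case M l b : b != 0 -> normal_form f1 f2 M l 0 b 0 0 ->
  cap #= `I_2 /\
  [/\ forall p, cap p -> singularity_A 3 f p, mdr f = 1%N & nearly_free f 1 3].
Proof.
move=> b0 nf; have l0 := nf_l_neq0 conic2 nf erefl.
have lDb := nf_l_neq_b conic2 nf erefl erefl erefl.
have [capE card] : cap = [set` [:: <[e100 K *m M]>%VS; conic_point M 0]] /\ cap #= `I_2.
  apply: (cap_seq conic1 conic2 nf (s := [:: 0])) => // t.
  rewrite (_ : _ + _ = b * t ^+ 2); last by ring.
  rewrite inE; split=> [/eqP|/eqP ->]; last by rewrite expr0n mulr0.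
  by rewrite mulf_eq0 (negPf b0) expf_eq0.
(* Stated for every frame, since the second tacnode is treated in a frame with the two points
   exchanged; tangency at both points gives [a' = 0] and [c' = 0] there. *)
have A3 M' l' b' : normal_form f1 f2 M' l' 0 b' 0 0 -> singularity_A 3 f <[e100 K *m M']>%VS.
  move=> nf'; have b'0 : b' != 0.
    by apply/eqP => b'0; case: (nf_coef_neq0 conic2 distinct nf').
  by apply: (nf_tangency conic2 nf' (m := 0) (e0 := b') (e1 := 0) (e2 := 0)) => // y; ring.
split=> //; split.
- move=> p; rewrite capE /= !inE => /orP[/eqP ->|/eqP ->]; first exact: A3 nf.
  have ne0 : e100 K *m M != 0.
    by apply: (nf_neq0 nf); apply: row3_neq0; rewrite oner_eq0.
  have /(cap_vline conic1 conic2 ne0) [Ev1 Ev2] : cap <[e100 K *m M]>%VS.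
    by rewrite capE /= !inE eqxx.
  have /(cap_vline conic1 conic2 (conic_point_neq0 nf 0)) [Ew1 Ew2] : cap (conic_point M 0).
    by rewrite capE /= !inE eqxx orbT.
  have [M' [l' [a' [b' [c' [k [k0 nf' wE vE]]]]]]] := nf_two conic1 conic2
    (conic_point_neq0 nf 0) ne0 Ew1 Ew2 Ev1 Ev2 (conic_point_neq nf 0).
  have a'0 : a' = 0.
    apply/(nf_tangent_base nf'); rewrite -wE expr0n.
    by apply/(nf_tangent_opposite nf).
  have [c'0 _] : c' = 0 /\ (0 : K) = 0.
    apply/(nf_tangent_opposite nf'); rewrite -vE /e100 scalemxAl.
    rewrite (_ : k *: _ = row3 k 0 0); last first.
      by apply: row3_eq; rewrite !mxE /= ?mulr1 ?mulr0.
    by apply/(nf_tangent nf); exists l; split; ring.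
  rewrite /conic_point wE; apply: (A3 _ l' b').
  by rewrite a'0 c'0 in nf'.
- apply: (nf_mdr1 conic2 distinct nf).
  apply: (AR_deg_neq0 (two_tacnodes_gen_deg l b o0)).
  apply/eqP => /rowP/(_ o0); rewrite !mxE /= => /eqP; apply/negP.
  exact: mpolyX_neq0.
- apply: (nf_nearly_free conic1 conic2 distinct nf) => //.
  exact: two_tacnodes_generator_degrees.
Qed.

Lemma tacnode_case M l b c : b != 0 -> c != 0 -> normal_form f1 f2 M l 0 b c 0 ->
  [/\ cap #= `I_3,
      exists2 p, cap p & singularity_A 3 f p /\
        forall q, cap q -> q <> p -> singularity_A 1 f q
    & mdr f = 2%N].
Proof.
move=> b0 c0 nf; have l0 := nf_l_neq0 conic2 nf erefl.
pose s := [:: 0; - c / b].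
have sE t : 0 * t ^+ 3 + b * t ^+ 2 + c * t + 0 = 0 <-> t \in s.
  rewrite (_ : _ + _ = b * (t * (t - (- c / b)))); last by field.
  rewrite !inE -[X in _ || X]subr_eq0; split=> [/eqP|H]; first by rewrite !mulf_eq0 (negPf b0).
  by apply/eqP; rewrite !mulf_eq0 (negPf b0).
have [capE card] : cap = [set` <[e100 K *m M]>%VS :: map (conic_point M) s] /\ cap #= `I_3.
  apply: (cap_seq conic1 conic2 nf sE).
  by rewrite /= inE andbT eq_sym mulf_neq0 ?oppr_eq0 ?invr_eq0.
split=> //.
- exists <[e100 K *m M]>%VS; first by rewrite capE /= inE eqxx.
  split.
    by apply: (nf_tangency conic2 nf (m := 0) (e0 := b) (e1 := c) (e2 := 0)) => // y; ring.
  move=> q; rewrite capE => qs.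
  have {qs} : q \in <[e100 K *m M]>%VS :: map (conic_point M) s := qs.
  rewrite inE => /orP[/eqP -> //|/mapP [t ts ->]] _.
  have /(cap_vline conic1 conic2 (conic_point_neq0 nf t)) [E1 E2] : cap (conic_point M t).
    exact/(cap_conic_point conic1 conic2 nf)/sE.
  apply: (transverse_node conic1 conic2) => //; first exact: conic_point_neq0 nf t.
  (* The first equation forces m = l, and the second then says that the derivative of b t^2 + c t
     vanishes at t: but its roots 0 and - c / b are simple. *)
  case/(nf_tangent nf) => m [e0 e1 _].
  have ml : m = l by rewrite -[LHS]mulr1 -e0; ring.
  have e2 : 2 * b * t + c = 0.
    by rewrite -[RHS](subrr (- 2 * m * t)) -{1}e1 ml; ring.
  move/sE: ts; rewrite (_ : _ + _ = t * (b * t + c)); last by ring.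
  move/eqP; rewrite mulf_eq0 => /orP[/eqP t0|/eqP bt].
    by case/eqP: c0; rewrite -[RHS]e2 t0; ring.
  case/eqP: c0; apply: (lincomb_eq0 (c := 2) (d := -1) bt e2); ring.
- apply: (nf_mdr2 conic2 distinct nf); first exact: AR_deg1_tangent.
  exact: AR_deg2_pencil_neq0.
Qed.

Lemma nodal_case M l a b c : a != 0 -> c != 0 -> normal_form f1 f2 M l a b c 0 ->
  (forall v, v != 0 -> eval f1 v = 0 -> eval f2 v = 0 -> ~ tangent f1 f2 v) ->
  [/\ cap #= `I_4, forall p, cap p -> singularity_A 1 f p & mdr f = 2%N].
Proof.
move=> a0 c0 nf notan.
have [t1 t1E] := quadratic_root b c a0.
pose t2 := - b / a - t1.
have fact t : a * t ^+ 2 + b * t + c = a * ((t - t1) * (t - t2)).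
  have -> : c = - (a * t1 ^+ 2 + b * t1).
    by apply/eqP; rewrite -addr_eq0 addrC; apply/eqP.
  by rewrite /t2; field.
have cE : c = a * (t1 * t2) by have := fact 0; rewrite expr0n /= => e; apply: etrans (etrans _ e) _; ring.
have t10 : t1 != 0 by apply: contra_neq c0 => t10; rewrite cE t10; ring.
have t20 : t2 != 0 by apply: contra_neq c0 => t20; rewrite cE t20; ring.
have sE t : a * t ^+ 3 + b * t ^+ 2 + c * t + 0 = 0 <-> t \in [:: 0; t1; t2].
  rewrite (_ : _ + _ = t * (a * t ^+ 2 + b * t + c)); last by ring.
  rewrite fact !inE -[t == t1]subr_eq0 -[t == t2]subr_eq0.
  by split=> [/eqP|H]; [|apply/eqP; move: H]; rewrite !mulf_eq0 (negPf a0).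
(* A double root of the restricted quartic would be a point of tangency, excluded by [notan]. *)
have t12 : t1 != t2.
  apply/eqP => t12.
  have /(cap_vline conic1 conic2 (conic_point_neq0 nf t1)) [E1 E2] : cap (conic_point M t1).
    by apply/(cap_conic_point conic1 conic2 nf)/sE; rewrite !inE eqxx orbT.
  apply: (notan _ (conic_point_neq0 nf t1) E1 E2); apply/(nf_tangent nf).
  have bE : b = - (2 * a * t1).
    have : a * (t1 + t2) = - b by rewrite /t2; field.
    by rewrite -t12 => e; rewrite -[LHS]opprK -e; ring.
  (* The multiplier is read off the first component of the gradients, at z = 1. *)
  by exists (l + a * t1); rewrite bE cE -t12; split; ring.
have [capE card] : cap = [set` <[e100 K *m M]>%VS :: map (conic_point M) [:: 0; t1; t2]] /\
    cap #= `I_4.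
  apply: (cap_seq conic1 conic2 nf sE).
  by rewrite /= !inE negb_or ![0 == _]eq_sym t10 t20 t12.
split=> //.
- move=> p cp; have [[Pp _] _] := cp; have [v v0 pE] := P2P Pp.
  move: cp; rewrite pE => /(cap_vline conic1 conic2 v0) [E1 E2].
  apply: (transverse_node conic1 conic2) => //; exact: notan.
- apply: (nf_mdr2 conic2 distinct nf); first exact: AR_deg1_nodal.
  exact: AR_deg2_pencil_neq0.
Qed.

Theorem conic_pair_classification :
  [\/ [/\ cap #= `I_4,
          forall p, cap p -> singularity_A 1 f p
        & mdr f = 2%N],
      [/\ cap #= `I_3,
          exists2 p, cap p & singularity_A 3 f p /\
            forall q, cap q -> q <> p -> singularity_A 1 f q
        & mdr f = 2%N],
      cap #= `I_2 /\
        ([/\ forall p, cap p -> singularity_A 3 f p,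
             mdr f = 1%N
           & nearly_free f 1 3] \/
         [/\ exists2 p, cap p & singularity_A 1 f p /\
               forall q, cap q -> q <> p -> singularity_A 5 f q,
             mdr f = 2%N
           & nearly_free f 2 2])
    | [/\ cap #= `I_1,
          forall p, cap p -> singularity_A 7 f p,
          mdr f = 1%N
        & free_curve f]].
Proof.
have [[v [v0 fv1 fv2 tv]]|notan] :=
    pselect (exists v, [/\ v != 0, eval f1 v = 0, eval f2 v = 0 & tangent f1 f2 v]).
- have [M [l [a [b [c [d [nf vE]]]]]]] := nf_at conic1 conic2 v0 fv1 fv2.
  have a0 : a = 0 by apply/(nf_tangent_base nf); rewrite -vE.
  rewrite a0 in nf.
  have [[b0 c0]|bc] := pselect (b = 0 /\ c = 0).
    by apply: Or44; apply: hyperosculating_case nf.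
  (* As [b] or [c] is nonzero, the quartic has a root other than the base point, which yields a
     frame with [d = 0]. *)
  have [t tE] : exists t, b * t ^+ 2 + c * t + d = 0.
    have [b0|b0] := eqVneq b 0; last exact: quadratic_root.
    have c0 : c != 0 by apply/eqP => c0; apply: bc.
    by exists (- d / c); rewrite b0; field.
  have /(cap_vline conic1 conic2 (conic_point_neq0 nf t)) [E1 E2] : cap (conic_point M t).
    by apply/(cap_conic_point conic1 conic2 nf); rewrite mul0r add0r.
  have vDt : (<[v]> != <[row3 (t ^+ 2) t 1 *m M]>)%VS.
    by rewrite eq_sym vE; exact: (conic_point_neq nf t).
  have [M' [l' [a' [b' [c' [k [k0 nf' vE' _]]]]]]] :=
    nf_two conic1 conic2 v0 (conic_point_neq0 nf t) fv1 fv2 E1 E2 vDt.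
  have a'0 : a' = 0 by apply/(nf_tangent_base nf'); rewrite -vE'.
  rewrite a'0 in nf'; have [b'0|b'0] := eqVneq b' 0.
    rewrite b'0 in nf'; have c'0 : c' != 0.
      by apply/eqP => c'0; case: (nf_coef_neq0 conic2 distinct nf').
    by apply: Or43; have [card h] := osculating_case c'0 nf'; split=> //; right.
  have [c'0|c'0] := eqVneq c' 0.
    rewrite c'0 in nf'.
    by apply: Or43; have [card h] := two_tacnodes_case b'0 nf'; split=> //; left.
  by apply: Or42; apply: tacnode_case nf'.
have {}notan v : v != 0 -> eval f1 v = 0 -> eval f2 v = 0 -> ~ tangent f1 f2 v.
  by move=> v0 fv1 fv2 tv; apply: notan; exists v.
have [v [v0 fv1 fv2]] := common_point conic1 conic2.
have [M [l [a [b [c [d [nf vE]]]]]]] := nf_at conic1 conic2 v0 fv1 fv2.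
have a0 : a != 0.
  by apply/eqP => a0; apply: (notan v) => //; rewrite vE; apply/(nf_tangent_base nf).
have [t tE] := cubic_root b c d a0.
have /(cap_vline conic1 conic2 (conic_point_neq0 nf t)) [E1 E2] : cap (conic_point M t).
  exact/(cap_conic_point conic1 conic2 nf).
have vDt : (<[v]> != <[row3 (t ^+ 2) t 1 *m M]>)%VS.
  by rewrite eq_sym vE; exact: (conic_point_neq nf t).
have [M' [l' [a' [b' [c' [k [k0 nf' vE' wE]]]]]]] :=
  nf_two conic1 conic2 v0 (conic_point_neq0 nf t) fv1 fv2 E1 E2 vDt.
have a'0 : a' != 0.
  by apply/eqP => a'0; apply: (notan v) => //; rewrite vE'; apply/(nf_tangent_base nf').
(* As [d] is 0 in this frame, a vanishing [c'] would make the second point a tangency. *)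
have c'0 : c' != 0.
  apply/eqP => c'0; apply: (notan (row3 0 0 1 *m M')).
  - by apply: (nf_neq0 nf'); apply: row3_neq0; rewrite oner_eq0 !orbT.
  - by rewrite (nf_eval1 nf'); ring.
  - by rewrite (nf_eval2 nf') /pencil; ring.
  - by apply/(nf_tangent_opposite nf').
by apply: Or41; apply: nodal_case nf' notan.
Qed.

End MainCases.

Unset Implicit Arguments.

Theorem proposition5p5 (R : realType) (f1 f2 : polyS R[i])
    (smooth_f1 : smooth_conic f1) (smooth_f2 : smooth_conic f2)
    (distinct : curve f1 <> curve f2) :
  let f := f1 * f2 in
  let r := mdr f in
  let I := curve f1 `&` curve f2 in
  [\/ [/\ I #= `I_4,
          forall p, I p -> singularity_A 1 f p
        & r = 2%N],
      [/\ I #= `I_3,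
          exists2 p, I p & singularity_A 3 f p /\
            forall q, I q -> q <> p -> singularity_A 1 f q
        & r = 2%N],
      I #= `I_2 /\
        ([/\ forall p, I p -> singularity_A 3 f p,
             r = 1%N
           & nearly_free f 1 3] \/
         [/\ exists2 p, I p & singularity_A 1 f p /\
               forall q, I q -> q <> p -> singularity_A 5 f q,
             r = 2%N
           & nearly_free f 2 2])
    | [/\ I #= `I_1,
          forall p, I p -> singularity_A 7 f p,
          r = 1%N
        & free_curve f]].
Proof. exact: conic_pair_classification. Qed.
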